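(* Let $V$ be a finite-dimensional real normed space, $m\ge 1$ an integer, $p\ge 1$ a real number, and let $\omega$ be a control for which there is a constant $K>0$ such that $\omega(s,t)\ge K(t-s)^{p}$ for all $0\le s<t\le 1$. Then $C^{0,\omega,p}(G^{m}(V))$, with the metric $d_{\omega,p}$, is separable.
   Context: $T^{(m)}(V)=\bigoplus_{n=0}^{m}V^{\otimes n}$ is the truncated tensor algebra with (truncated) product $\otimes$; $\mathcal{G}^{m}(V)$ is its Lie subalgebra generated by $V$ for the bracket $[a,b]=a\otimes b-b\otimes a$; $G^{m}(V)=\exp(\mathcal{G}^{m}(V))$ is the free nilpotent Lie group of step $m$ over $V$, with product $\otimes$ and neutral element $1$. The dilation is $\delta_{t}(1+v_{1}+\dots+v_{m})=1+tv_{1}+\dots+t^{m}v_{m}$, $v_i\in V^{\otimes i}$, $t\in\mathbb{R}$. $\|\cdot\|_{m}$ is a fixed symmetric subadditive homogeneous norm on $G^{m}(V)$, i.e. a function $G^m(V)\to[0,\infty)$ with $\|g\|_m=0$ iff $g=1$, $\|\delta_t g\|_m=|t|\,\|g\|_m$, $\|g\otimes h\|_m\le\|g\|_m+\|h\|_m$, $\|g^{-1}\|_m=\|g\|_m$ (for instance the Carnot–Caratheodory norm; all such norms are equivalent since $\dim V<\infty$). Set $d_{m}(g,h)=\|g^{-1}\otimes h\|_{m}$. A $G^m(V)$-valued path is a continuous map $[0,1]\to G^{m}(V)$ starting at $1$; for such a path $Y_{s,t}:=Y_{s}^{-1}\otimes Y_{t}$. For a smooth path $y:[0,1]\to V$,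 the signature is $S_{m}(y)_{s,t}=1+\sum_{k=1}^{m}\int_{s<u_{1}<\dots<u_{k}<t}dy_{u_{1}}\otimes\dots\otimes dy_{u_{k}}\in G^{m}(V)$, and $S_m(y)$ denotes the $G^m(V)$-valued path $t\mapsto S_m(y)_{0,t}$. A control is a continuous function $\omega:\{(s,t):0\le s\le t\le 1\}\to[0,\infty)$ with $\omega(t,t)=0$ for all $t$ and $\omega(s,t)+\omega(t,u)\le\omega(s,u)$ for $s<t<u$. $d_{\omega,p}(x,y)=\sup_{0\le s<t\le 1}\frac{d_{m}(x_{s,t},y_{s,t})}{\omega(s,t)^{1/p}}$, and $C^{0,\omega,p}(G^{m}(V))$ is the $d_{\omega,p}$-closure, in the set of $G^m(V)$-valued paths, of $\{S_{m}(x): x \text{ a smooth } V\text{-valued path}\}$. *)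

(* Defs.v *)
(* MathComp / MathComp-Analysis *)
From HB Require Import structures.
From mathcomp Require Import all_boot all_order all_algebra.
From mathcomp Require Import all_classical all_reals all_analysis.

Set Implicit Arguments.
Unset Strict Implicit.
Unset Printing Implicit Defensive.

Import Order.TTheory GRing.Theory Num.Theory.
Import numFieldNormedType.Exports.
Local Open Scope classical_set_scope.
Local Open Scope ring_scope.

#[short(type="finNormedModType")]
HB.structure Definition FinNormedModule (R : numFieldType) :=
  {V of NormedModule R V & Vector R V}.

(* A tensor in [T^(m)(R^d)] is given by its coordinates in the basis
   [e_i1 (x) ... (x) e_ik], indexed by the words [i1 ... ik] of length
   [k <= m] over ['I_d]; the empty word indexes the scalar component. *)
Definition ttensor (R : realType) (d m : nat) : Type :=
  {ffun m.-bseq 'I_d -> R}.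

Section TruncatedTensorAlgebra.
Context {R : realType} {d m : nat}.
Local Notation word := (m.-bseq 'I_d).
Local Notation T := (ttensor R d m).

HB.instance Definition _ := Vector.copy T {ffun word -> R}.

Definition take_word (k : nat) (w : word) : word := [bseq of take k w].

Definition drop_word (k : nat) (w : word) : word :=
  widen_bseq (leq_subr k m) [bseq of drop k w].

Definition tone : T := [ffun w : word => (size w == 0%N)%:R].

(* Every word has length at most [m], so this is the truncated product. *)
Definition tmul (a b : T) : T :=
  [ffun w : word =>
     \sum_(k < (size w).+1) a (take_word k w) * b (drop_word k w)].

Lemma tmulA : associative tmul.
Proof.
move=> a b c; apply/ffunP => w; rewrite !ffunE.
pose F (i j : nat) := a (take_word i w) * b (drop_word i (take_word j w))
                      * c (drop_word j w).
transitivity (\sum_(0 <= i < (size w).+1) \sum_(i <= j < (size w).+1) F i j).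
  rewrite big_mkord; apply: eq_bigr => i _; rewrite ffunE mulr_sumr /=.
  have iw : (i <= size w)%N by rewrite -ltnS.
  rewrite [RHS](big_addn 0 _ i) subSn // big_mkord size_drop.
  apply: eq_bigr => j _; rewrite /F mulrA.
  congr (a _ * b _ * c _); apply/val_inj => /=; last by rewrite drop_drop.
  by rewrite take_drop.
transitivity (\sum_(0 <= j < (size w).+1) \sum_(0 <= i < j.+1) F i j).
  have widen i : (0 <= i < (size w).+1)%N -> \sum_(i <= j < (size w).+1) F i j =
      \sum_(0 <= j < (size w).+1 | (i <= j)%N) F i j.
    by move=> _; rewrite (big_nat_widenl _ 0).
  rewrite (eq_big_nat _ _ widen) (exchange_big_dep_nat predT) //=.
  apply: eq_big_nat => j jw; rewrite [RHS](big_nat_widen _ _ (size w).+1) //.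
rewrite big_mkord; apply: eq_bigr => j _.
have sj : size (take j w) = j by rewrite size_takel // -ltnS.
rewrite ffunE mulr_suml /= sj big_mkord; apply: eq_bigr => i _.
rewrite /F; congr (a _ * _ * _); apply/val_inj => /=.
by rewrite take_takel // -ltnS.
Qed.

Lemma tmul1l : left_id tone tmul.
Proof.
move=> a; apply/ffunP => w; rewrite !ffunE big_ord_recl big1 => [|i _].
  rewrite addr0 ffunE /= take0 mul1r.
  by congr (a _); apply/val_inj; rewrite /= drop0.
rewrite ffunE /= size_takel ?mul0r //; exact: ltn_ord.
Qed.

Lemma tmul1r : right_id tone tmul.
Proof.
move=> a; apply/ffunP => w; rewrite !ffunE big_ord_recr big1 /= => [|i _].
  rewrite add0r ffunE /= drop_size mulr1.
  by congr (a _); apply/val_inj; rewrite /= take_size.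
by rewrite ffunE /= size_drop subn_eq0 leqNgt ltn_ord mulr0.
Qed.

Lemma tmulDl : left_distributive tmul +%R.
Proof.
move=> a b c; apply/ffunP => w; rewrite !ffunE -big_split.
by apply: eq_bigr => i _; rewrite ffunE mulrDl.
Qed.

Lemma tmulDr : right_distributive tmul +%R.
Proof.
move=> a b c; apply/ffunP => w; rewrite !ffunE -big_split.
by apply: eq_bigr => i _; rewrite ffunE mulrDr.
Qed.

Lemma tone_neq0 : tone != 0.
Proof.
by apply/eqP => /ffunP /(_ [bseq]) /eqP; rewrite !ffunE /= oner_eq0.
Qed.

HB.instance Definition _ := GRing.Zmodule_isNzRing.Build T
  tmulA tmul1l tmul1r tmulDl tmulDr tone_neq0.

Lemma tscaleAl (k : R) (a b : T) : k *: (a * b) = (k *: a) * b.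
Proof.
apply/ffunP => w; rewrite !ffunE scaler_sumr.
by apply: eq_bigr => i _; rewrite ffunE -mulrA.
Qed.

HB.instance Definition _ := GRing.Lmodule_isLalgebra.Build R T tscaleAl.

Lemma tscaleAr (k : R) (a b : T) : k *: (a * b) = a * (k *: b).
Proof.
apply/ffunP => w; rewrite !ffunE scaler_sumr.
by apply: eq_bigr => i _; rewrite ffunE mulrCA.
Qed.

HB.instance Definition _ := GRing.Lalgebra_isAlgebra.Build R T tscaleAr.

(* On tensors with zero scalar component, where it is used, this finite sum is
   the exponential series, as [a ^+ m.+1 = 0] (lemma [tnilp]). *)
Definition texp (a : T) : T := \sum_(k < m.+1) (k`!%:R)^-1 *: a ^+ k.

(* The Neumann series: the inverse of any [g] with scalar component 1
   (lemmas [tmulV] and [tmulVr]). *)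
Definition tinv (g : T) : T := \sum_(k < m.+1) (1 - g) ^+ k.

Definition dil (t : R) (g : T) : T := [ffun w : word => t ^+ size w * g w].

Lemma texpr_small (a : T) k (w : word) :
  a [bseq] = 0 -> (size w < k)%N -> (a ^+ k) w = 0.
Proof.
move=> a0; elim: k w => // k IHk w; rewrite ltnS => wk.
rewrite exprS ffunE big1 // => -[[|i] /= ilt] _.
  by rewrite (_ : take_word 0 w = [bseq]) ?a0 ?mul0r //;
     apply/val_inj; rewrite /= take0.
rewrite IHk ?mulr0 //= size_drop (leq_trans _ wk) //.
by rewrite ltn_subrL /=; apply: leq_ltn_trans (leq0n i) _; rewrite -ltnS.
Qed.

Lemma tnilp (a : T) : a [bseq] = 0 -> a ^+ m.+1 = 0.
Proof.
move=> a0; apply/ffunP => w; rewrite [RHS]ffunE.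
by apply: texpr_small => //; rewrite ltnS size_bseq.
Qed.

Lemma tmulV (g : T) : g [bseq] = 1 -> g * tinv g = 1.
Proof.
move=> g1; pose x : T := 1 - g.
have x0 : x [bseq] = 0 by rewrite !ffunE g1 /= subrr.
have -> : g = 1 - x by rewrite opprB addrC subrK.
rewrite /tinv; under eq_bigr do rewrite opprB addrC subrK.
by rewrite -[1 - x]opprB mulNr -subrX1 tnilp // sub0r opprK.
Qed.

Lemma tmulVr (g : T) : g [bseq] = 1 -> tinv g * g = 1.
Proof.
move=> g1; have gc : tinv g * g = g * tinv g.
  rewrite /tinv mulr_sumr mulr_suml; apply: eq_bigr => k _.
  apply/esym/commrX; rewrite /GRing.comm mulrBr mulrBl mulr1 mul1r //.
by rewrite gc tmulV.
Qed.

End TruncatedTensorAlgebra.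

(* [T^(m)(V)], in the coordinates given by the basis [vbasis fullv] of [V]. *)
Definition tensor_of (R : realType) (V : finNormedModType R) (m : nat) : Type :=
  ttensor R (\dim (fullv : {vspace V})) m.

HB.instance Definition _ (R : realType) (V : finNormedModType R) (m : nat) :=
  GRing.Algebra.copy (tensor_of V m) (ttensor R (\dim (fullv : {vspace V})) m).

Section Signatures.
Context {R : realType} {V : finNormedModType R} {m : nat}.
Local Notation letter := ('I_(\dim (fullv : {vspace V}))).
Local Notation word := (m.-bseq letter).
Local Notation T := (tensor_of V m).
Local Notation mu := (@lebesgue_measure R).

Definition vcoord (i : letter) (v : V) : R := coord (vbasis fullv) i v.

(* The inclusion of [V] into [T^(m)(V)] as tensors of degree 1. *)
Definition tvec (v : V) : T :=
  [ffun w : word => if w : seq letter is [:: i] then vcoord i v else (0 : R)].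

Inductive lie_gen : T -> Prop :=
| lie_gen_vec v : lie_gen (tvec v)
| lie_gen_lin (c : R) a b : lie_gen a -> lie_gen b -> lie_gen (c *: a + b)
| lie_gen_bracket a b : lie_gen a -> lie_gen b -> lie_gen (a * b - b * a).

Definition Gm : set T := [set texp a | a in lie_gen].

(* Paths on [0, 1] are represented by functions on [R]; only their values on
   [0, 1] matter. *)
Definition incr (Y : R -> T) (s t : R) : T := tinv (Y s) * Y t.

(* Continuity for the canonical topology of the finite-dimensional space
   [T^(m)(V)], i.e. coordinatewise. *)
Definition Gpath (Y : R -> T) : Prop :=
  [/\ Y 0 = 1,
      forall t, t \in `[0, 1] -> Gm (Y t) &
      forall w : word, {within `[0, 1], continuous (fun t => Y t w)}].

(* A smooth path on the closed interval [0, 1] is the restriction of a smooth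
   function on [R]. *)
Definition smooth (y : R -> V) : Prop :=
  forall n t, derivable (derive1n n y) t 1.

(* The coordinate along [e_i1 (x) ... (x) e_ik] of the integral of
   [dy_u1 (x) ... (x) dy_uk] over [s < u1 < ... < uk < t], the outermost
   integration being in [u1]. *)
Fixpoint iterated_integral (y : R -> V) (w : seq letter) (s t : R) : R :=
  if w is i :: w' then
    \int[mu]_(u in `[s, t]) (vcoord i (derive1 y u) * iterated_integral y w' u t)
  else 1.

Definition signature (y : R -> V) (s t : R) : T :=
  [ffun w : word => iterated_integral y w s t].

Definition signature_path (y : R -> V) : R -> T := signature y 0.

(* Only the values of [N] on [G^m(V)] are constrained and used. *)
Record homogeneous_norm (N : T -> R) : Prop := HomogeneousNorm {
  hnorm_ge0 : forall g, Gm g -> 0 <= N g;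
  hnorm_eq0 : forall g, Gm g -> (N g = 0 <-> g = 1);
  hnorm_dil : forall t g, Gm g -> N (dil t g) = `|t| * N g;
  hnorm_mul : forall g h, Gm g -> Gm h -> N (g * h) <= N g + N h;
  hnorm_inv : forall g, Gm g -> N (tinv g) = N g }.

Definition dm (N : T -> R) (g h : T) : R := N (tinv g * h).

Definition d_omega_p (N : T -> R) (omega : R -> R -> R) (p : R)
    (x y : R -> T) : \bar R :=
  ereal_sup [set r | exists s t, [/\ 0 <= s, s < t, t <= 1 &
    r = (dm N (incr x s t) (incr y s t) / (omega s t `^ p^-1))%:E]].

(* The [d_omega_p]-closure, among [G^m(V)]-valued paths, of the lifts of smooth
   paths. *)
Definition C0 (N : T -> R) (omega : R -> R -> R) (p : R) : set (R -> T) :=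
  [set Y | Gpath Y /\ forall e : R, 0 < e -> exists x : R -> V,
     smooth x /\ (d_omega_p N omega p Y (signature_path x) < e%:E)%E].

End Signatures.

Record control (R : realType) (omega : R -> R -> R) : Prop := Control {
  control_continuous :
    {within [set z : R * R | [/\ 0 <= z.1, z.1 <= z.2 & z.2 <= 1]],
       continuous (fun z : R * R => omega z.1 z.2)};
  control_ge0 : forall s t, 0 <= s -> s <= t -> t <= 1 -> 0 <= omega s t;
  control_diag : forall t, 0 <= t -> t <= 1 -> omega t t = 0;
  control_superadditive : forall s t u, 0 <= s -> s < t -> t < u -> u <= 1 ->
    omega s t + omega t u <= omega s u }.

Definition separable_metric (R : realType) (X : Type) (dist : X -> X -> \bar R)
    (C : set X) : Prop :=
  exists D : set X, [/\ countable D, D `<=` C &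
    forall x, C x -> forall e : R, 0 < e ->
      exists2 z, D z & (dist x z < e%:E)%E].

(* Main.v *)
Require Import Defs.
From mathcomp Require Import all_boot all_order all_algebra.
From mathcomp Require Import all_classical all_reals all_analysis.
From HB Require Import structures.
From mathcomp Require Import ring lra.
Set Implicit Arguments.
Unset Strict Implicit.
Unset Printing Implicit Defensive.
Import Order.TTheory GRing.Theory Num.Theory.
Import numFieldNormedType.Exports.
Local Open Scope classical_set_scope.
Local Open Scope ring_scope.

(** A path [x] is replaced by its velocity, on which the signature depends
    continuously: if the velocities of [x] and [y] are bounded by [M] and
    uniformly close, then [S(x)_(s,t)^-1 * S(y)_(s,t)] is [1] plus a tensor
    whose component of degree [k] is at most [eps^k * (t - s)^k], so its norm is
    [O(eps * (t - s))], which [omega s t ^ (1/p)] dominates. Velocities are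
    continuous on [[0, 1]] and are distinguished up to a given precision by
    countably many codes; for each code and precision one element of [C0] is
    chosen among those close to the lift of a path with that code.

    The norm is not assumed continuous. It is bounded on bounded subsets of the
    group because every element is, degree by degree, a product of iterated
    group commutators of dilated exponentials of letters.

    That the group is closed under products and contains the signatures is read
    off the logarithmic derivative along dilations: with [D] the derivation
    that multiplies degree [k] by [k], [g] is the exponential of a Lie element
    iff [(D g) * g^-1] is a Lie element, a property preserved by [g' = alpha * g]
    for [alpha] with values in the Lie algebra. *)

(** * Grading of the truncated tensor algebra and its Lie subalgebra *)

Section GradedAlgebra.
Context {R : realType} {d m : nat}.
Local Notation word := (m.-bseq 'I_d).
Local Notation T := (ttensor R d m).

Definition deg_ge (k : nat) (a : T) := forall w : word, (size w < k)%N -> a w = 0.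

Definition trunc (k : nat) (a : T) : T :=
  [ffun w : word => if (size w < k)%N then a w else 0].

(** The infinitesimal generator of the dilations. *)
Definition degree_der (a : T) : T := [ffun w : word => (size w)%:R * a w].

Lemma tmulE (a b : T) (w : word) :
  (a * b) w = \sum_(k < (size w).+1) a (take_word k w) * b (drop_word k w).
Proof. by rewrite /GRing.mul /= ffunE. Qed.

Lemma toneE (w : word) : (1 : T) w = (size w == 0%N)%:R.
Proof. by rewrite /GRing.one /= ffunE. Qed.

Lemma tscaleE (c : R) (a : T) (w : word) : (c *: a) w = c * a w.
Proof. by rewrite ffunE. Qed.

Lemma taddE (a b : T) (w : word) : (a + b) w = a w + b w.
Proof. by rewrite ffunE. Qed.

Lemma toppE (a : T) (w : word) : (- a) w = - a w.
Proof. by rewrite ffunE. Qed.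

Lemma take_word0 (w : word) : take_word 0 w = [bseq].
Proof. by apply: val_inj; rewrite /= take0. Qed.

Lemma drop_word0 (w : word) : drop_word 0 w = w.
Proof. by apply: val_inj; rewrite /= drop0. Qed.

Lemma tmul_nil (a b : T) : (a * b) [bseq] = a [bseq] * b [bseq].
Proof.
by rewrite tmulE big_ord_recl big_ord0 addr0 take_word0 drop_word0.
Qed.

Lemma degree_der_is_linear : linear degree_der.
Proof. by move=> c a b; apply/ffunP => w; rewrite !ffunE mulrDr mulrCA. Qed.
HB.instance Definition _ :=
  GRing.isLinear.Build R T T _ degree_der degree_der_is_linear.

Lemma degree_derM (a b : T) :
  degree_der (a * b) = degree_der a * b + a * degree_der b.
Proof.
apply/ffunP => w; rewrite !ffunE mulr_sumr -big_split /=.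
apply: eq_bigr => -[k /= kw] _; rewrite !ffunE /= size_takel ?size_drop //.
rewrite -mulrA [a _ * (_ * _)]mulrCA -mulrDl -natrD subnKC //.
Qed.

Lemma degree_der1 : degree_der 1 = 0.
Proof.
apply/ffunP => w; rewrite !ffunE.
by case: eqP => [->|_]; rewrite ?mul0r ?mulr0.
Qed.

Lemma trunc_is_linear k : linear (trunc k).
Proof.
by move=> c a b; apply/ffunP => w; rewrite !ffunE; case: ifP => //; rewrite scaler0 addr0.
Qed.
HB.instance Definition _ k :=
  GRing.isLinear.Build R T T _ (trunc k) (trunc_is_linear k).

Lemma deg_ge_trunc k (a : T) : deg_ge k (a - trunc k a).
Proof. by move=> w wk; rewrite !ffunE wk subrr. Qed.

Lemma trunc0_deg_ge k (a : T) : deg_ge k a <-> trunc k a = 0.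
Proof.
split=> [h|h w wk]; first by apply/ffunP => w; rewrite !ffunE; case: ifP => // /h.
by have /ffunP/(_ w) := h; rewrite !ffunE wk.
Qed.

Lemma trunc_full (a : T) : trunc m.+1 a = a.
Proof. by apply/ffunP => w; rewrite !ffunE ltnS size_bseq. Qed.

Lemma deg_ge_full (a : T) : deg_ge m.+1 a -> a = 0.
Proof. by move/trunc0_deg_ge; rewrite trunc_full. Qed.

Lemma deg_ge_le k l (a : T) : (k <= l)%N -> deg_ge l a -> deg_ge k a.
Proof. by move=> kl h w wk; apply: h; apply: leq_trans kl. Qed.

Lemma deg_ge0 k : deg_ge k 0.
Proof. by move=> w _; rewrite ffunE. Qed.

Lemma deg_geD k (a b : T) : deg_ge k a -> deg_ge k b -> deg_ge k (a + b).
Proof. by move=> ha hb w wk; rewrite ffunE ha // hb // addr0. Qed.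

Lemma deg_geZ k c (a : T) : deg_ge k a -> deg_ge k (c *: a).
Proof. by move=> ha w wk; rewrite ffunE ha // scaler0. Qed.

Lemma deg_geN k (a : T) : deg_ge k a -> deg_ge k (- a).
Proof. by rewrite -scaleN1r; apply: deg_geZ. Qed.

Lemma deg_geB k (a b : T) : deg_ge k a -> deg_ge k b -> deg_ge k (a - b).
Proof. by move=> ha hb; apply: deg_geD => //; apply: deg_geN. Qed.

Lemma deg_ge_sum k (I : Type) (r : seq I) (P : pred I) (F : I -> T) :
  (forall i, P i -> deg_ge k (F i)) -> deg_ge k (\sum_(i <- r | P i) F i).
Proof. by move=> h; elim/big_ind: _ => //; [exact: deg_ge0|exact: deg_geD]. Qed.

Lemma deg_geM k l (a b : T) : deg_ge k a -> deg_ge l b -> deg_ge (k + l) (a * b).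
Proof.
move=> ha hb w wk; rewrite tmulE big1 // => -[i /= iw] _.
have iw' : (i <= size w)%N by [].
case: (ltnP i k) => ik; first by rewrite ha ?mul0r //= size_takel.
rewrite (hb (drop_word i w)) ?mulr0 //= size_drop ltn_subLR //.
by rewrite (leq_trans wk) // leq_add2r.
Qed.

Lemma deg_ge1P (a : T) : deg_ge 1 a <-> a [bseq] = 0.
Proof.
split=> [|a0 w]; first exact.
by rewrite ltnS leqn0 => /eqP/size0nil w0; rewrite (_ : w = [bseq]) //; apply: val_inj.
Qed.

Lemma deg_ge_mull k (a b : T) : deg_ge k b -> deg_ge k (a * b).
Proof. by move=> hb; rewrite -[k]add0n; apply: deg_geM. Qed.

Lemma deg_ge_mulr k (a b : T) : deg_ge k a -> deg_ge k (a * b).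
Proof. by move=> hb; rewrite -[k]addn0; apply: deg_geM. Qed.

Definition letter (i : 'I_d) : T := [ffun w : word => (val w == [:: i])%:R].

(** Right-nested brackets of letters. They are homogeneous and, by [lie_bracket], already span a Lie
    algebra. *)
Fixpoint rbracket (s : seq 'I_d) : T :=
  match s with
  | [::] => 0
  | [:: i] => letter i
  | i :: s' => letter i * rbracket s' - rbracket s' * letter i
  end.

Lemma rbracket_cons i j s : rbracket [:: i, j & s] =
  letter i * rbracket (j :: s) - rbracket (j :: s) * letter i.
Proof. by []. Qed.

Definition homog (k : nat) (a : T) := forall w : word, size w != k -> a w = 0.

Lemma homog_letter i : homog 1 (letter i).
Proof. by move=> w wk; rewrite ffunE; case: (val w =P _) wk => // ->. Qed.

Lemma homogM k l (a b : T) : homog k a -> homog l b -> homog (k + l) (a * b).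
Proof.
move=> ha hb w wk; rewrite tmulE big1 // => -[i /= iw] _.
have [ik|ik] := eqVneq i k; last first.
  by rewrite ha ?mul0r //= size_takel.
rewrite (hb (drop_word i w)) ?mulr0 //= size_drop.
apply: contraNneq wk => <-; rewrite -ik subnKC //.
Qed.

Lemma homog_rbracket s : homog (size s) (rbracket s).
Proof.
elim: s => [|i [|j s] IHs]; first by move=> w _; rewrite ffunE.
  exact: homog_letter.
move=> w wk; rewrite rbracket_cons taddE toppE (homogM (@homog_letter i) IHs) ?add1n //.
by rewrite (homogM IHs (@homog_letter i)) ?addn1 // subrr.
Qed.

Lemma homog_deg_ge k (a : T) : homog k a -> deg_ge k a.
Proof. by move=> ha w wk; apply: ha; rewrite ltn_eqF. Qed.

Lemma degree_der_homog k (a : T) : homog k a -> degree_der a = k%:R *: a.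
Proof.
move=> ha; apply/ffunP => w; rewrite !ffunE.
by have [->//|/ha ->] := eqVneq (size w) k; rewrite mulr0 scaler0.
Qed.

Lemma trunc_homog k l (a : T) : homog k a ->
  trunc l a = if (k < l)%N then a else 0.
Proof.
move=> ha; apply/ffunP => w; rewrite !ffunE.
have [->|/ha aw0] := eqVneq (size w) k; first by case: ifP; rewrite ?ffunE.
by rewrite aw0 if_same; case: (k < l)%N; rewrite ?aw0 // ffunE.
Qed.

(** Words of length at most [m] suffice, since longer brackets vanish. Being a span of finitely many
    tensors, this space has projections and coordinates; [lie_genP] identifies it with the Lie
    algebra generated by [V]. *)
Definition lie : {vspace T} := <<[seq rbracket (val w) | w : word]>>%VS.

Lemma rbracket_lie s : rbracket s \in lie.
Proof.
have [sm|sm] := leqP (size s) m; last first.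
  rewrite (@deg_ge_full (rbracket s)) ?mem0v //.
  exact: deg_ge_le sm (homog_deg_ge (@homog_rbracket s)).
by apply: memv_span; apply/mapP; exists (Bseq sm); rewrite ?mem_enum.
Qed.

Lemma lie_ind (P : T -> Prop) :
  P 0 -> (forall c a b, P a -> P b -> P (c *: a + b)) ->
  (forall s, P (rbracket s)) -> forall a, a \in lie -> P a.
Proof.
move=> P0 PD PB a; rewrite /lie => /(@coord_span _ _ _ (in_tuple _)) ->.
apply: (big_ind P) => // [x y Px Py|i _]; first by rewrite -[x]scale1r; apply: PD.
rewrite -[X in P X]addr0; apply: PD => //=.
have: nth (0 : T) [seq rbracket (val w) | w : word] i \in [seq rbracket (val w) | w : word].
  by apply: mem_nth; case: i.
by case/mapP => w _ ->.
Qed.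

Lemma lie_letter i : letter i \in lie.
Proof. exact: (rbracket_lie [:: i]). Qed.

Lemma lie_letter_bracket i a : a \in lie -> letter i * a - a * letter i \in lie.
Proof.
move: a; apply: lie_ind.
- by rewrite mulr0 mul0r subr0 mem0v.
- move=> c a b ha hb; rewrite mulrDr mulrDl -scalerAr -scalerAl.
  by rewrite opprD addrACA -scalerBr memvD // memvZ.
- case=> [|j s]; first by rewrite /= mulr0 mul0r subr0 mem0v.
  exact: (rbracket_lie [:: i, j & s]).
Qed.

(** By the Jacobi identity, bracketing with [[i, x]] reduces to bracketing with the letter [i] and
    with the shorter [x]. The induction keeps [b] arbitrary because [x] is also bracketed with
    [[i, b]]. *)
Lemma lie_bracket a b : a \in lie -> b \in lie -> a * b - b * a \in lie.
Proof.
move=> ha; move: a ha b; apply: lie_ind.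
- by move=> b _; rewrite mulr0 mul0r subr0 mem0v.
- move=> c a a' ha ha' b hb; rewrite mulrDr mulrDl -scalerAr -scalerAl.
  by rewrite opprD addrACA -scalerBr memvD ?ha' // memvZ ?ha.
- elim=> [|i [|j s] IHs] b hb; first by rewrite /= mulr0 mul0r subr0 mem0v.
    exact: lie_letter_bracket.
  rewrite rbracket_cons; move: (rbracket (j :: s)) IHs => x IHx.
  have -> : (letter i * x - x * letter i) * b - b * (letter i * x - x * letter i) =
     (letter i * (x * b - b * x) - (x * b - b * x) * letter i) -
     (x * (letter i * b - b * letter i) - (letter i * b - b * letter i) * x).
    rewrite !(mulrBl, mulrBr) !mulrA.
    by apply/ffunP => w; rewrite !(taddE, toppE); ring.
  by rewrite memvB ?IHx // lie_letter_bracket // IHx.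
Qed.

Lemma lie_deg_ge1 a : a \in lie -> deg_ge 1 a.
Proof.
move: a; apply: lie_ind; first exact: deg_ge0.
  by move=> c a b ha hb; apply: deg_geD => //; apply: deg_geZ.
case=> [|i s]; first exact: deg_ge0.
exact: (deg_ge_le _ (homog_deg_ge (@homog_rbracket (i :: s)))).
Qed.

Lemma lie_nil a : a \in lie -> a [bseq] = 0.
Proof. by move=> /lie_deg_ge1/deg_ge1P. Qed.

(** The spanning brackets are homogeneous, so the subspace is graded. *)
Lemma lie_trunc k a : a \in lie -> trunc k a \in lie.
Proof.
move: a; apply: lie_ind; first by rewrite linear0 mem0v.
  by move=> c a b ha hb; rewrite linearP memvD // memvZ.
move=> s; rewrite (trunc_homog _ (@homog_rbracket s)).
by case: ifP => _; rewrite ?mem0v ?rbracket_lie.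
Qed.

Lemma lie_degree_der a : a \in lie -> degree_der a \in lie.
Proof.
move: a; apply: lie_ind; first by rewrite linear0 mem0v.
  by move=> c a b ha hb; rewrite linearP memvD // memvZ.
by move=> s; rewrite (degree_der_homog (@homog_rbracket s)) memvZ ?rbracket_lie.
Qed.

End GradedAlgebra.

(** * Differential calculus for tensor-valued curves *)

Section Curves.
Context {R : realType} {d m : nat}.
Local Notation word := (m.-bseq 'I_d).
Local Notation T := (ttensor R d m).

Lemma is_derive_bigsum (I : Type) (r : seq I) (F : I -> R -> R) (dF : I -> R) (t : R) :
  (forall i, is_derive t (1 : R) (F i) (dF i)) ->
  is_derive t (1 : R) (fun s => \sum_(i <- r) F i s) (\sum_(i <- r) dF i).
Proof.
move=> h; elim: r => [|i r IHr].
  rewrite big_nil (_ : (fun _ => _) = cst 0); first exact: is_derive_cst.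
  by apply/funext => s; rewrite big_nil.
rewrite big_cons (_ : (fun _ => _) = F i + (fun s => \sum_(i <- r) F i s)).
  exact: is_deriveD.
by apply/funext => s; rewrite big_cons.
Qed.

(* Coordinatewise differentiation: [ttensor] carries no topology. *)
Definition tder (P Q : R -> T) :=
  forall t w, is_derive t (1 : R) (fun s => P s w) (Q t w).

Lemma tder_eq P Q Q' : tder P Q -> (forall t, Q t = Q' t) -> tder P Q'.
Proof. by move=> h e t w; rewrite -e. Qed.

Lemma tder_cst a : tder (fun=> a) (fun=> 0).
Proof. by move=> t w; rewrite ffunE; exact: is_derive_cst. Qed.

Lemma tderD P Q P' Q' : tder P P' -> tder Q Q' ->
  tder (fun t => P t + Q t) (fun t => P' t + Q' t).
Proof.
move=> hP hQ t w; rewrite taddE.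
rewrite (_ : (fun _ => _) = (fun s => P s w) + (fun s => Q s w)).
  exact: is_deriveD.
by apply/funext => s; rewrite taddE.
Qed.

Lemma tderM P Q P' Q' : tder P P' -> tder Q Q' ->
  tder (fun t => P t * Q t) (fun t => P' t * Q t + P t * Q' t).
Proof.
move=> hP hQ t w; rewrite taddE !tmulE -big_split /=.
rewrite (_ : (fun _ => _) = (fun s => \sum_(k < (size w).+1)
   P s (take_word k w) * Q s (drop_word k w))).
  apply: is_derive_bigsum => i.
  pose f s := P s (take_word i w); pose g s := Q s (drop_word i w).
  have H := @is_deriveM R R f g t 1 _ _ (hP t (take_word i w)) (hQ t (drop_word i w)).
  apply: (is_derive_eq H); rewrite addrC /GRing.scale /=.
  by rewrite [g t * _]mulrC.
by apply/funext => s; rewrite tmulE.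
Qed.

Lemma tensor_sum_basis (a : T) :
  a = \sum_(u : word) a u *: [ffun w : word => (w == u)%:R].
Proof.
apply/ffunP => w; rewrite sum_ffunE (bigD1 w) //= big1 => [|u /negPf uw].
  by rewrite addr0 tscaleE ffunE eqxx mulr1.
by rewrite tscaleE ffunE eq_sym uw mulr0.
Qed.

(** Each coordinate of [f a] is a fixed finite linear combination of the coordinates of [a]. *)
Lemma tder_linear (f : {linear T -> T}) P Q :
  tder P Q -> tder (fun t => f (P t)) (fun t => f (Q t)).
Proof.
move=> h t w.
have E (a : T) : f a w = \sum_(u : word) a u * f [ffun w => (w == u)%:R] w.
  rewrite {1}(tensor_sum_basis a) linear_sum sum_ffunE.
  by apply: eq_bigr => u _; rewrite linearZ tscaleE.
rewrite E (_ : (fun _ => _) = (fun s => \sum_(u : word)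
   P s u * f [ffun w => (w == u)%:R] w)); last by apply/funext => s; rewrite E.
apply: is_derive_bigsum => u.
pose c : R := f [ffun w => (w == u)%:R] w.
have := @is_deriveZ R R R (fun s => P s u) c t 1 _ (h t u).
rewrite [c *: _]mulrC; congr is_derive.
by apply/funext => s; rewrite /= mulrC.
Qed.

Lemma tder0_const P : tder P (fun=> 0) -> forall s t, P s = P t.
Proof.
move=> h s t; apply/ffunP => w.
apply: (@is_derive_0_is_cst R (fun s => P s w)) => x.
by have := h x w; rewrite ffunE.
Qed.

Lemma tder_unique P Q Q' : tder P Q -> tder P Q' -> forall t, Q t = Q' t.
Proof.
move=> h h' t; apply/ffunP => w.
by rewrite -(@derive_val _ _ _ _ _ _ _ (h t w)) -(@derive_val _ _ _ _ _ _ _ (h' t w)).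
Qed.

Lemma tderX_ex P P' k : tder P P' -> exists Q, tder (fun t => P t ^+ k) Q.
Proof.
move=> h; elim: k => [|k [Q hQ]]; first by exists (fun=> 0); exact: tder_cst.
eexists; under eq_fun do rewrite exprS; exact: tderM.
Qed.

Lemma tinv_uniq (g h : T) : g [bseq] = 1 -> h * g = 1 -> h = tinv g.
Proof. by move=> g1 hg; rewrite -[LHS]mulr1 -(tmulV g1) mulrA hg mul1r. Qed.

Lemma tinv_nil (g : T) : g [bseq] = 1 -> tinv g [bseq] = 1.
Proof.
move=> g1; have := congr1 (fun a : T => a [bseq]) (tmulV g1).
by rewrite /= tmul_nil g1 mul1r toneE.
Qed.

Lemma tinv_derivable P P' : tder P P' -> exists Q, tder (fun t => tinv (P t)) Q.
Proof.
move=> h; rewrite /tinv.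
have h1 : tder (fun t => 1 - P t) (fun t => 0 - P' t).
  apply: tderD; first exact: tder_cst.
  by apply: (@tder_linear (GRing.opp : {linear T -> T})).
have /choice[Q hQ] := fun k => tderX_ex k h1.
exists (fun t => \sum_(k < m.+1) Q k t) => t w; rewrite sum_ffunE.
rewrite (_ : (fun _ => _) = (fun s => \sum_(k < m.+1) ((1 - P s) ^+ k) w)).
  by apply: is_derive_bigsum => k; exact: hQ.
by apply/funext => s; rewrite sum_ffunE.
Qed.

(** The inverse is derivable as a polynomial in [P]; differentiating [tinv (P t) * P t = 1] then
    determines its derivative. *)
Lemma tderV (P P' : R -> T) : (forall t, P t [bseq] = 1) -> tder P P' ->
  tder (fun t => tinv (P t)) (fun t => - (tinv (P t) * P' t * tinv (P t))).
Proof.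
move=> P1 h; have [Q hQ] := tinv_derivable h; apply: (tder_eq hQ) => t.
have := tderM hQ h; under eq_fun do rewrite tmulVr //.
move=> /tder_unique/(_ (tder_cst 1))/(_ t)/eqP.
rewrite addr_eq0 => /eqP E.
by rewrite -[LHS]mulr1 -(tmulV (P1 t)) mulrA E mulNr.
Qed.

(** The identity minus the projection onto [U] has kernel [U], and it maps [P] to a curve with zero
    derivative. *)
Lemma tder_in_vspace (U : {vspace T}) P Q t0 : tder P Q ->
  (forall t, Q t \in U) -> P t0 \in U -> forall t, P t \in U.
Proof.
move=> h QU PU t.
pose f : 'End(T) := (\1 - projv U)%VF.
have fU a : (f a == 0) = (a \in U).
  rewrite lfunE /= lfunE /= lfunE subr_eq0; apply/eqP/idP => [->|/projv_id//].
  exact: memv_proj.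
have hf : tder (fun t => f (P t)) (fun=> 0).
  apply: tder_eq (tder_linear f h) _ => s; apply/eqP; by rewrite fU.
by rewrite -fU (tder0_const hf t t0) fU.
Qed.

(* Truncating below degree [k + 1] the bracket with [alpha] only involves the
   truncation of [v] below degree [k], since [alpha] has no scalar component. *)
Lemma lie_ode (alpha beta v : R -> T) t0 :
  (forall t, alpha t \in lie) -> (forall t, beta t \in lie) ->
  tder v (fun t => beta t + (alpha t * v t - v t * alpha t)) ->
  v t0 \in lie -> forall t, v t \in lie.
Proof.
move=> La Lb dv Lv t; rewrite -[v t]trunc_full.
elim: m.+1 t => [|k IHk] t.
  by rewrite (_ : trunc 0 _ = 0) ?mem0v //; apply/ffunP => w; rewrite !ffunE.
move: t; apply: (tder_in_vspace (tder_linear (trunc k.+1) dv)); last exact: lie_trunc Lv.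
move=> t; rewrite linearD memvD //; first exact: lie_trunc.
set a := alpha t; set u := v t; rewrite -[X in X \in _]/(trunc k.+1 (a * u - u * a)).
have -> : trunc k.+1 (a * u - u * a) =
          trunc k.+1 (a * trunc k u - trunc k u * a).
  apply/eqP; rewrite -subr_eq0 -linearB; apply/eqP/trunc0_deg_ge.
  have -> : a * u - u * a - (a * trunc k u - trunc k u * a) =
            a * (u - trunc k u) - (u - trunc k u) * a.
    rewrite mulrBr mulrBl; apply/ffunP => w; rewrite !(taddE, toppE); ring.
  apply: deg_geB; first by rewrite -add1n; apply: deg_geM (lie_deg_ge1 (La t)) (@deg_ge_trunc _ _ _ _ _).
  by rewrite -addn1; apply: deg_geM (@deg_ge_trunc _ _ _ _ _) (lie_deg_ge1 (La t)).
by apply: lie_trunc; apply: lie_bracket (La t) (IHk t).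
Qed.

End Curves.

(** * The group of exponentials of Lie elements *)

Section LieGroup.
Context {R : realType} {d m : nat}.
Local Notation word := (m.-bseq 'I_d).
Local Notation T := (ttensor R d m).

(* For [g = texp a] the logarithmic derivative [degree_der g * g^-1] is a Lie
   element; conversely this property characterizes the exponentials of Lie
   elements (lemma [lgrp_exp]), and it is stable along [g' = alpha * g] with
   [alpha] a Lie element, which replaces the Campbell-Hausdorff formula. *)
Definition lgrp (g : T) := g [bseq] = 1 /\ degree_der g * tinv g \in lie.

Lemma lgrp_nil g : lgrp g -> g [bseq] = 1.
Proof. by case. Qed.

Lemma lgrp1 : lgrp 1.
Proof. by split; rewrite ?toneE // degree_der1 mul0r mem0v. Qed.

Lemma ode_nil (alpha g : R -> T) t0 : (forall t, alpha t [bseq] = 0) ->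
  tder g (fun t => alpha t * g t) -> forall t, g t [bseq] = g t0 [bseq].
Proof.
move=> a0 dg t; apply: (@is_derive_0_is_cst R (fun s => g s [bseq])) => x.
by have := dg x [bseq]; rewrite tmul_nil a0 mul0r.
Qed.

(** For [v = degree_der g * tinv g] the equation gives [v' = degree_der alpha + (alpha * v - v *
    alpha)], so [lie_ode] applies. *)
Lemma lgrp_ode (alpha g : R -> T) t0 : (forall t, alpha t \in lie) ->
  tder g (fun t => alpha t * g t) -> lgrp (g t0) -> forall t, lgrp (g t).
Proof.
move=> La dg [g1 Lg].
have g1t t : g t [bseq] = 1.
  by rewrite (ode_nil t0 _ dg) // => s; exact: lie_nil.
move=> t; split=> //; move: t.
have La' t : degree_der (alpha t) \in lie by exact: lie_degree_der.
apply: (lie_ode La La' _ Lg).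
have H := tderM (tder_linear (degree_der : {linear T -> T}) dg) (tderV g1t dg).
apply: (tder_eq H) => t /=.
rewrite -[X in X * tinv (g t) + _]/(degree_der (alpha t * g t)).
rewrite degree_derM mulrDl -!mulrA tmulV // !mulr1 mulrN -addrA.
by rewrite !mulrA.
Qed.

Lemma texp0 : texp (0 : T) = 1.
Proof.
rewrite /texp big_ord_recl big1 => [|i _]; last by rewrite expr0n scaler0.
by rewrite addr0 expr0 fact0 invr1 scale1r.
Qed.

Lemma texp_comm (a b : T) : GRing.comm b a -> GRing.comm b (texp a).
Proof.
move=> ba; rewrite /GRing.comm /texp mulr_sumr mulr_suml; apply: eq_bigr => k _.
by rewrite -scalerAl -scalerAr (commrX k ba).
Qed.

Lemma tder_texp (a : T) : a [bseq] = 0 ->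
  tder (fun t => texp (t *: a)) (fun t => a * texp (t *: a)).
Proof.
move=> a0 t w.
have E s : texp (s *: a) w = \sum_(k < m.+1) (k`!%:R^-1 * (a ^+ k) w) * s ^+ k.
  rewrite sum_ffunE; apply: eq_bigr => k _.
  rewrite exprZn !tscaleE. by rewrite mulrCA mulrC.
have -> : (a * texp (t *: a)) w =
    \sum_(k < m.+1) (k`!%:R^-1 * (a ^+ k) w) * (k%:R * t ^+ k.-1).
  rewrite /texp mulr_sumr sum_ffunE [RHS]big_ord_recl /= mul0r mulr0 add0r.
  rewrite [LHS]big_ord_recr /= exprZn -!scalerAr -exprS tnilp // !scaler0 [X in _ + X]ffunE addr0.
  apply: eq_bigr => k _; rewrite exprZn -!scalerAr !tscaleE -exprS /= /bump /= add1n /=.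
  rewrite factS natrM invfM.
  have : k.+1%:R != 0 :> R by rewrite pnatr_eq0.
  move: (k.+1%:R : R) (k`!%:R^-1 : R) ((a ^+ k.+1) w) (t ^+ k) => x y z u.
  by rewrite /GRing.scale /= => x0; field.
rewrite (_ : (fun _ => _) = (fun s => \sum_(k < m.+1)
   (k`!%:R^-1 * (a ^+ k) w) * s ^+ k)); last by apply/funext => s; exact: E.
apply: is_derive_bigsum => k; set c := _ * _.
have dX : is_derive t (1 : R) (fun s : R => s ^+ k) ((k%:R * t ^+ k.-1) *: 1).
  by have := is_deriveX k (is_derive_id t (1 : R)); rewrite exprfctE.
have H := @is_deriveZ R R R (fun s => s ^+ k) c t 1 _ dX.
apply: (is_derive_eq H); by rewrite /GRing.scale /= mulr1.
Qed.

Lemma texp_nil (a : T) : a [bseq] = 0 -> texp a [bseq] = 1.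
Proof.
move=> a0; have := ode_nil 0 (fun=> a0) (tder_texp a0) 1.
by rewrite scale1r scale0r texp0 toneE.
Qed.

Lemma texpNM (a : T) : a [bseq] = 0 -> texp (- a) * texp a = 1.
Proof.
move=> a0.
have Na0 : (- a) [bseq] = 0 by rewrite toppE a0 oppr0.
have H := tderM (tder_texp Na0) (tder_texp a0).
have : tder (fun t => texp (t *: - a) * texp (t *: a)) (fun=> 0).
  apply: (tder_eq H) => t; rewrite mulrA.
  have -> : texp (t *: - a) * a = a * texp (t *: - a).
    apply/esym/texp_comm; rewrite scalerN; apply: commrN.
    by rewrite /GRing.comm -scalerAl -scalerAr.
  by rewrite -!mulrA mulNr addNr.
move/tder0_const/(_ 1 0).
by rewrite !scale1r !scale0r texp0 mulr1.
Qed.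

Lemma texpMN (a : T) : a [bseq] = 0 -> texp a * texp (- a) = 1.
Proof. by move=> a0; rewrite -{1}[a]opprK texpNM // toppE a0 oppr0. Qed.

Lemma tinv_texp (a : T) : a [bseq] = 0 -> tinv (texp a) = texp (- a).
Proof. by move=> a0; rewrite -(tinv_uniq (texp_nil a0) (texpNM a0)). Qed.

(** The curve [texp (t *: a) * h] solves [g' = a * g] and joins [h] to [texp a * h]. *)
Lemma lgrp_texpM a h : a \in lie -> lgrp h -> lgrp (texp a * h).
Proof.
move=> La Lh; have a0 := lie_nil La.
have H := tderM (tder_texp a0) (tder_cst h).
have H' : tder (fun t => texp (t *: a) * h) (fun t => a * (texp (t *: a) * h)).
  by apply: (tder_eq H) => t; rewrite mulr0 addr0 mulrA.
have := @lgrp_ode (fun=> a) _ 0 (fun=> La) H'.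
by rewrite scale0r texp0 mul1r => /(_ Lh 1); rewrite scale1r.
Qed.

Lemma lgrp_texp a : a \in lie -> lgrp (texp a).
Proof. by move=> La; rewrite -[texp a]mulr1; apply: lgrp_texpM lgrp1. Qed.

Lemma exprD_deg_ge k (a z : T) n : (0 < k)%N -> deg_ge 1 a -> deg_ge k z ->
  deg_ge k ((a + z) ^+ n - a ^+ n).
Proof.
move=> k0 ha hz; elim: n => [|n IHn]; first by rewrite subrr; exact: deg_ge0.
have -> : (a + z) ^+ n.+1 - a ^+ n.+1 =
          (a + z) * ((a + z) ^+ n - a ^+ n) + z * a ^+ n.
  by rewrite !exprS mulrBr [(a + z) * a ^+ n]mulrDl opprD addrA subrK.
by apply: deg_geD; [exact: deg_ge_mull | exact: deg_ge_mulr].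
Qed.

(** For [n >= 2], every term of the expansion containing [z] has another factor of degree at least
    1. *)
Lemma exprD_deg_geS k (a z : T) n : (0 < k)%N -> deg_ge 1 a -> deg_ge k z ->
  (n != 1)%N -> deg_ge k.+1 ((a + z) ^+ n - a ^+ n).
Proof.
move=> k0 ha hz; case: n => [|[|n]] // _; first by rewrite subrr; exact: deg_ge0.
have -> : (a + z) ^+ n.+2 - a ^+ n.+2 =
          (a + z) * ((a + z) ^+ n.+1 - a ^+ n.+1) + z * a ^+ n.+1.
  by rewrite ![_ ^+ n.+2]exprS mulrBr [(a + z) * a ^+ _]mulrDl opprD addrA subrK.
apply: deg_geD.
  rewrite -add1n; apply: deg_geM; last exact: exprD_deg_ge.
  by apply: deg_geD => //; exact: deg_ge_le hz.
by rewrite -addn1; apply: deg_geM => //; rewrite exprS; exact: deg_ge_mulr.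
Qed.

Lemma texpD_deg_ge k (a z : T) : (0 < m)%N -> (0 < k)%N ->
  deg_ge 1 a -> deg_ge k z -> deg_ge k.+1 (texp (a + z) - texp a - z).
Proof.
move=> m0 k0 ha hz; rewrite /texp -sumrB.
(* The linear term of the series, present because [0 < m], contributes exactly [z]. *)
rewrite (bigD1 (Ordinal (m0 : (1 < m.+1)%N))) //= !expr1 (_ : 1`! = 1%N) // invr1 !scale1r.
rewrite addrAC [a + z]addrC addrK subrr add0r; apply: deg_ge_sum => i i1.
rewrite -scalerBr; apply: deg_geZ; rewrite [z + a]addrC; exact: exprD_deg_geS.
Qed.

Lemma degree_der_trunc k (a : T) : degree_der (trunc k a) = trunc k (degree_der a).
Proof. by apply/ffunP => w; rewrite !ffunE; case: ifP; rewrite ?mulr0. Qed.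

Lemma deg_ge_der k (a : T) : deg_ge k a -> deg_ge k (degree_der a).
Proof. by move=> ha w wk; rewrite ffunE ha // mulr0. Qed.

Lemma homog_trunc k (a : T) : deg_ge k a -> homog k (trunc k.+1 a).
Proof.
move=> ha w wk; rewrite ffunE ltnS leq_eqVlt (negPf wk) /=.
by case: ifP => // /ha.
Qed.

Lemma tinv_sub1_deg_ge k (g : T) :
  g [bseq] = 1 -> deg_ge k (g - 1) -> deg_ge k (tinv g - 1).
Proof.
move=> g1 hg; have -> : tinv g - 1 = - (tinv g * (g - 1)).
  by rewrite mulrBr tmulVr // mulr1 opprB.
exact/deg_geN/deg_ge_mull.
Qed.

(** If [z] is the degree [k] part of [g - 1], the lowest term of [degree_der g * tinv g] is
    [k%:R *: z]; the Lie algebra is graded and [k] is invertible. *)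
Lemma lgrp_leading k (g : T) : (0 < k)%N -> lgrp g -> deg_ge k (g - 1) ->
  trunc k.+1 (g - 1) \in lie.
Proof.
move=> k0 [g1 Lg] hg; set z := trunc _ _.
have hz : homog k z by exact: homog_trunc.
have kz : (k%:R : R) *: z \in lie.
  rewrite -(degree_der_homog hz) degree_der_trunc.
  have -> : trunc k.+1 (degree_der (g - 1)) = trunc k.+1 (degree_der g * tinv g).
    have -> : degree_der g = degree_der (g - 1) by rewrite linearB /= degree_der1 subr0.
    apply/eqP; rewrite eq_sym -subr_eq0 -linearB; apply/eqP/trunc0_deg_ge.
    rewrite -[X in _ - X]mulr1 -mulrBr.
    apply: (@deg_ge_le _ _ _ _ (k + k)%N); first by rewrite -addn1 leq_add2l.
    exact: deg_geM (deg_ge_der hg) (tinv_sub1_deg_ge g1 hg).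
  exact: lie_trunc.
have k1 : (k%:R : R) != 0 by rewrite pnatr_eq0 -lt0n.
by rewrite -[z]scale1r -(mulVf k1) -scalerA memvZ.
Qed.

(** The logarithm is built degree by degree: the leading term [z] of [texp (- a) * g - 1] is a Lie
    element, and replacing [a] by [a + z] cancels it. *)
Lemma lgrp_exp (g : T) : (0 < m)%N -> lgrp g -> exists2 a, a \in lie & g = texp a.
Proof.
move=> m0 Lg; have g1 := lgrp_nil Lg.
have main k : exists2 a, a \in lie & deg_ge k.+1 (texp (- a) * g - 1).
  elim: k => [|k [a La ha]].
    exists 0; rewrite ?mem0v // oppr0 texp0 mul1r.
    by apply/deg_ge1P; rewrite taddE toppE g1 toneE subrr.
  have a0 := lie_nil La.
  have Lh : lgrp (texp (- a) * g) by apply: lgrp_texpM => //; rewrite memvN.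
  have Lz := lgrp_leading (isT : (0 < k.+1)%N) Lh ha.
  have hz := @deg_ge_trunc _ _ _ k.+2 (texp (- a) * g - 1).
  have zk := homog_deg_ge (homog_trunc ha).
  move: (trunc _ _) Lz hz zk => z Lz hz zk.
  exists (a + z); first exact: memvD.
  have LNa : deg_ge 1 (- a) by apply/deg_geN/lie_deg_ge1.
  have He := texpD_deg_ge m0 (isT : (0 < k.+1)%N)
    LNa (deg_geN zk).
  rewrite opprD; set x := texp (- a - z).
  have -> : x * g - 1 = (texp (- a) * g - 1 - z) + (x - texp (- a) - - z) * g - z * (g - 1).
    rewrite !(mulrBl, mulrBr) mulNr mulr1.
    by apply/ffunP => w; rewrite !(taddE, toppE); ring.
  apply: deg_geB; first by apply: deg_geD => //; exact: deg_ge_mulr.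
  rewrite -addn1; apply: deg_geM => //.
  by apply/deg_ge1P; rewrite taddE toppE g1 toneE subrr.
have [a La] := main m; have a0 := lie_nil La.
move/deg_ge_full/eqP; rewrite subr_eq0 => /eqP E; exists a => //.
by rewrite -[RHS]mulr1 -E mulrA texpMN // mul1r.
Qed.

Lemma lgrpM (g h : T) : (0 < m)%N -> lgrp g -> lgrp h -> lgrp (g * h).
Proof. by move=> m0 /(lgrp_exp m0)[a La ->]; exact: lgrp_texpM. Qed.

Lemma lgrpV (g : T) : (0 < m)%N -> lgrp g -> lgrp (tinv g).
Proof.
move=> m0 /(lgrp_exp m0)[a La ->]; rewrite tinv_texp ?lie_nil //.
by apply: lgrp_texp; rewrite memvN.
Qed.

End LieGroup.

(** * Graded bounds, dilations and group commutators *)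

Section NormBound.
Context {R : realType} {d m : nat}.
Local Notation word := (m.-bseq 'I_d).
Local Notation T := (ttensor R d m).

(** The scaling of a signature over an interval of length [h]: degree [k] has size [h ^+ k]. *)
Definition graded_bound (c h : R) (a : T) := forall w : word, `|a w| <= c * h ^+ size w.

Lemma graded_bound_ge0 c h (a : T) : graded_bound c h a -> 0 <= c.
Proof. by move/(_ [bseq]); rewrite expr0 mulr1; apply: le_trans. Qed.

Lemma graded_bound_le c c' h (a : T) : 0 <= h -> c <= c' ->
  graded_bound c h a -> graded_bound c' h a.
Proof.
move=> h0 cc' ha w; apply: le_trans (ha w) _.
by rewrite ler_wpM2r // exprn_ge0.
Qed.

Lemma graded_boundD c c' h (a b : T) :
  graded_bound c h a -> graded_bound c' h b -> graded_bound (c + c') h (a + b).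
Proof.
move=> ha hb w; rewrite taddE mulrDl; apply: le_trans (ler_normD _ _) _.
exact: lerD.
Qed.

Lemma graded_boundN c h (a : T) : graded_bound c h a -> graded_bound c h (- a).
Proof. by move=> ha w; rewrite toppE normrN. Qed.

Lemma graded_bound1 h : 0 <= h -> graded_bound 1 h 1.
Proof.
move=> h0 w; rewrite toneE mul1r; case: eqP => [->|_]; first by rewrite normr1 expr0.
by rewrite normr0 exprn_ge0.
Qed.

Lemma graded_boundM c c' h (a b : T) : 0 <= h ->
  graded_bound c h a -> graded_bound c' h b ->
  graded_bound (m.+1%:R * (c * c')) h (a * b).
Proof.
move=> h0 ha hb w; rewrite tmulE; apply: le_trans (ler_norm_sum _ _ _) _.
have c0 := graded_bound_ge0 ha; have c'0 := graded_bound_ge0 hb.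
apply: (@le_trans _ _ (\sum_(k < (size w).+1) (c * c' * h ^+ size w))).
  apply: ler_sum => -[k /= kw] _; rewrite normrM.
  have := ler_pM (normr_ge0 _) (normr_ge0 _) (ha (take_word k w)) (hb (drop_word k w)).
  move/le_trans; apply; rewrite mulrACA -exprD /= size_takel // size_drop subnKC //.
rewrite sumr_const card_ord -[X in X <= _]mulr_natl mulrA; apply: ler_wpM2r; first exact: exprn_ge0.
by apply: ler_wpM2r; [exact: mulr_ge0 | rewrite ler_nat ltnS size_bseq].
Qed.

(** The constant is chosen before [h] and [a], because [h] will be the length of an arbitrary
    interval. *)
Lemma graded_boundX c n : exists C, forall h (a : T), 0 <= h ->
  graded_bound c h a -> graded_bound C h (a ^+ n).
Proof.
elim: n => [|n [C IHn]]; first by exists 1 => h a h0 _; exact: graded_bound1.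
eexists => h a h0 ha; rewrite exprS.
exact: graded_boundM (IHn _ _ h0 ha).
Qed.

Lemma graded_boundV c : exists C, forall h (g : T), 0 <= h ->
  graded_bound c h g -> graded_bound C h (tinv g).
Proof.
rewrite /tinv; elim: m.+1 => [|n [C IHn]].
  exists 0 => h g h0 _; rewrite big_ord0 => w.
  by rewrite ffunE normr0 mul0r.
have [C' hC'] := graded_boundX (1 + c) n.
exists (C + C') => h g h0 hg; rewrite big_ord_recr /=.
apply: graded_boundD; first exact: IHn.
by apply: hC' => //; apply: graded_boundD; [exact: graded_bound1|exact: graded_boundN].
Qed.

Lemma graded_bound_ex (a : T) : exists C, graded_bound C 1 a.
Proof.
exists (\sum_(w : word) `|a w|) => w; rewrite expr1n mulr1 (bigD1 w) //=.
by rewrite lerDl sumr_ge0.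
Qed.

Lemma dilM t (a b : T) : dil t (a * b) = dil t a * dil t b.
Proof.
apply/ffunP => w; rewrite tmulE ffunE tmulE mulr_sumr; apply: eq_bigr => -[k /= kw] _.
by rewrite !ffunE mulrACA -exprD /= size_takel // size_drop subnKC.
Qed.

Lemma dil1 t : dil t (1 : T) = 1.
Proof.
apply/ffunP => w; rewrite ffunE toneE.
by case: eqP => [->|]; rewrite ?mulr0 // expr0 mul1r.
Qed.

Lemma dil_is_linear t : linear (dil t : T -> T).
Proof. by move=> c a b; apply/ffunP => w; rewrite !ffunE mulrDr mulrCA. Qed.
HB.instance Definition _ t :=
  GRing.isLinear.Build R T T _ (dil t) (dil_is_linear t).

Lemma dilX t (a : T) n : dil t (a ^+ n) = dil t a ^+ n.
Proof. by elim: n => [|n IHn]; rewrite ?dil1 // !exprS dilM IHn. Qed.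

Lemma dil_texp t (a : T) : dil t (texp a) = texp (dil t a).
Proof.
by rewrite /texp linear_sum; apply: eq_bigr => k _; rewrite linearZ /= dilX.
Qed.

Lemma dil_homog t k (a : T) : homog k a -> dil t a = t ^+ k *: a.
Proof.
move=> ha; apply/ffunP => w; rewrite tscaleE ffunE.
by have [->//|/ha ->] := eqVneq (size w) k; rewrite !mulr0.
Qed.

Lemma lie_dil t (a : T) : a \in lie -> dil t a \in lie.
Proof.
move: a; apply: lie_ind; first by rewrite linear0 mem0v.
  by move=> c a b ha hb; rewrite linearP memvD // memvZ.
by move=> s; rewrite (dil_homog t (@homog_rbracket _ _ _ s)) memvZ ?rbracket_lie.
Qed.

Lemma dil_dil s t (a : T) : dil s (dil t a) = dil (s * t) a.
Proof. by apply/ffunP => w; rewrite !ffunE mulrA -exprMn. Qed.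

Lemma dil_id (a : T) : dil 1 a = a.
Proof. by apply/ffunP => w; rewrite ffunE expr1n mul1r. Qed.

Hypothesis m_gt0 : (0 < m)%N.

Lemma lgrp_dil t (g : T) : lgrp g -> lgrp (dil t g).
Proof.
case/(lgrp_exp m_gt0) => a La ->; rewrite dil_texp; exact/lgrp_texp/lie_dil.
Qed.

(* [gbracket s c] is an iterated group commutator with leading term
   [c *: rbracket s]. *)
Fixpoint gbracket (s : seq 'I_d) (c : R) : T :=
  match s with
  | [::] => 1
  | [:: i] => dil c (texp (letter i))
  | i :: s' => texp (letter i) * gbracket s' c * tinv (texp (letter i)) * tinv (gbracket s' c)
  end.

Lemma gbracket_cons i j s c : gbracket [:: i, j & s] c =
  texp (letter i) * gbracket (j :: s) c * tinv (texp (letter i)) * tinv (gbracket (j :: s) c).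
Proof. by []. Qed.

Lemma lgrp_letter i : lgrp (texp (letter i : T)).
Proof. exact/lgrp_texp/lie_letter. Qed.

Lemma lgrp_gbracket s c : lgrp (gbracket s c).
Proof.
elim: s => [|i [|j s] IHs]; first exact: lgrp1.
  exact/lgrp_dil/lgrp_letter.
rewrite gbracket_cons; have Lx := lgrp_letter i.
by apply: lgrpM (lgrpV _ _) => //; apply: lgrpM (lgrpV _ _) => //; exact: lgrpM.
Qed.

Lemma texp_deg_ge2 (a : T) : deg_ge 1 a -> deg_ge 2 (texp a - 1 - a).
Proof.
move=> ha; have h0 : deg_ge 1 (0 : T) by exact: deg_ge0.
by have := texpD_deg_ge m_gt0 (isT : (0 < 1)%N) h0 ha; rewrite add0r texp0.
Qed.

(** For [x] and [y] in the group, [x * y * tinv x * tinv y - 1] is [K * q] with [K] the commutator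
    of [x - 1] and [y - 1], and [q] the inverse of [y * x]. Up to higher degree, [q] is 1 and [K] is
    the bracket of the leading terms. The scalar enters through the dilation of the last letter
    only, so the leading term is linear in [c], whatever its sign. *)
Lemma gbracket_leading s c : deg_ge (size s).+1 (gbracket s c - 1 - c *: rbracket s).
Proof.
elim: s => [|i [|j s] IHs].
- by rewrite /= subrr scaler0 subr0; exact: deg_ge0.
- rewrite /= dil_texp (dil_homog _ (@homog_letter _ _ _ i)) expr1.
  apply: texp_deg_ge2; apply: deg_geZ; apply: homog_deg_ge; exact: homog_letter.
rewrite gbracket_cons rbracket_cons.
have Ly := lgrp_gbracket (j :: s) c.
have hB : deg_ge (size (j :: s)) (c *: rbracket (j :: s) : T).
  by apply: deg_geZ; apply: homog_deg_ge; exact: homog_rbracket.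
have hl : deg_ge 1 (letter i : T) by apply: homog_deg_ge; exact: homog_letter.
have Lx := lgrp_letter i; have hx := texp_deg_ge2 hl.
rewrite scalerBr scalerAr scalerAl.
move: (texp (letter i : T)) Lx hx => x Lx hx.
move: (gbracket (j :: s) c) (c *: rbracket (j :: s) : T) (letter i : T) hx hl Ly hB IHs =>
  y B l hx hl Ly hB IHs.
set k := (size (j :: s)) in hB IHs *; rewrite -[size _]/k.+1.
have hu : deg_ge 1 (x - 1).
  by rewrite -[x - 1](subrK l); apply: deg_geD => //; exact: deg_ge_le (isT : (1 <= 2)%N) hx.
have hv : deg_ge k (y - 1).
  by rewrite -[y - 1](subrK B); apply: deg_geD => //; exact: deg_ge_le (leqnSn k) IHs.
have x1 := lgrp_nil Lx; have y1 := lgrp_nil Ly.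
pose q := tinv x * tinv y.
have hq : deg_ge 1 (q - 1).
  by apply/deg_ge1P; rewrite taddE toppE tmul_nil !tinv_nil // toneE mulr1 subrr.
pose K := (x - 1) * (y - 1) - (y - 1) * (x - 1).
have KE : x * y - y * x = K.
  rewrite /K !(mulrBl, mulrBr) !mul1r !mulr1.
  by apply/ffunP => w; rewrite !(taddE, toppE); ring.
have qE : y * x * q = 1 by rewrite /q mulrA -[y * x * _]mulrA tmulV // mulr1 tmulV.
have -> : x * y * tinv x * tinv y - 1 - (l * B - B * l) =
   K * (q - 1) + (K - (l * B - B * l)).
  rewrite -[x * y * _ * _]mulrA -/q mulrBr mulr1 -{1}KE mulrBl qE.
  by rewrite addrA subrK.
have hK : deg_ge k.+1 K.
  apply: deg_geB; first by rewrite -add1n; exact: deg_geM.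
  by rewrite -addn1; exact: deg_geM.
apply: deg_geD; first by rewrite -addn1; exact: deg_geM.
have -> : K - (l * B - B * l) = (x - 1 - l) * (y - 1) + l * (y - 1 - B)
   - (y - 1 - B) * (x - 1) - B * (x - 1 - l).
  rewrite /K; move: (x - 1) (y - 1) => u v; rewrite !(mulrBl, mulrBr).
  by apply/ffunP => w; rewrite !(taddE, toppE); ring.
apply: deg_geB; first apply: deg_geB; first apply: deg_geD.
- by rewrite -add2n; exact: deg_geM.
- by rewrite -add1n; exact: deg_geM.
- by rewrite -addn1; exact: deg_geM.
- by rewrite -addn2; exact: deg_geM.
Qed.

End NormBound.

(** * Homogeneous norms are bounded on bounded sets *)

Section HomogeneousNormBound.
Context {R : realType} {d m : nat}.
Local Notation word := (m.-bseq 'I_d).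
Local Notation T := (ttensor R d m).
Hypothesis m_gt0 : (0 < m)%N.

(** The brackets span but may be dependent; [coord] still gives linear functionals that reconstruct
    each Lie element, and linear functionals are bounded on bounded sets. *)
Lemma lie_coef : exists (phi : 'I_#|{: word}| -> {scalar T}) (M : R),
  (forall z, z \in lie -> z = \sum_i phi i z *: rbracket (val (enum_val i : word))) /\
  (forall i c a, graded_bound c 1 a -> `|phi i a| <= M * c).
Proof.
pose X := image_tuple (fun w : word => rbracket (val w) : T) predT.
pose phi i : {scalar T} := coord X i.
pose M := \sum_i \sum_(u : word) `|phi i [ffun w : word => (w == u)%:R]|.
exists phi, M; split.
  move=> z /(coord_span (X := X)) {1}->; apply: eq_bigr => i _.
  by rewrite /phi /X /= nth_image.
move=> i c a ha; rewrite {1}(tensor_sum_basis a) linear_sum.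
have c0 := graded_bound_ge0 ha.
apply: le_trans (ler_norm_sum _ _ _) _.
rewrite /M (bigD1 i) //= mulrDl -[X in X <= _]addr0; apply: lerD; last first.
  by rewrite mulr_ge0 // sumr_ge0 // => j _; rewrite sumr_ge0.
rewrite mulr_suml; apply: ler_sum => u _; rewrite linearZ /= normrM mulrC.
by rewrite ler_wpM2l //; have := ha u; rewrite expr1n mulr1.
Qed.

Lemma graded_bound_dil c (a : T) t r : `|t| <= r ->
  graded_bound c 1 a -> graded_bound (c * (1 + r) ^+ m) 1 (dil t a).
Proof.
move=> tr ha w; rewrite ffunE normrM normrX expr1n mulr1 mulrC.
have r0 : 0 <= r := le_trans (normr_ge0 t) tr.
apply: ler_pM; rewrite ?exprn_ge0 //; first by have := ha w; rewrite expr1n mulr1.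
apply: (@le_trans _ _ ((1 + r) ^+ size w)).
  by rewrite lerXn2r ?nnegrE ?addr_ge0 // (le_trans tr) // lerDr.
by apply: ler_weXn2l; rewrite ?lerDl // size_bseq.
Qed.

(** The form in which a homogeneous norm enters the estimates, on the group written as [lgrp]. *)
Definition lnorm (N : T -> R) := [/\ N 1 = 0,
  forall t g, lgrp g -> N (dil t g) = `|t| * N g,
  forall g h, lgrp g -> lgrp h -> N (g * h) <= N g + N h &
  forall g, lgrp g -> N (tinv g) = N g].

(** On a dilated letter [N] is [|c|] times a fixed number; subadditivity and symmetry handle
    commutators. The bound on coordinates is carried along because the product of these elements
    will have to be inverted. *)
Lemma gbracket_bound N s r : lnorm N -> exists C, forall c, `|c| <= r ->
  graded_bound C 1 (gbracket s c : T) /\ N (gbracket s c) <= C.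
Proof.
move=> [N1 Nd NM NV]; elim: s => [|i [|j s] [C IHs]].
- exists 1 => c _; split; first exact: graded_bound1.
  by rewrite /= N1.
- have [C' hC'] := graded_bound_ex (texp (letter i) : T).
  exists (Num.max (C' * (1 + r) ^+ m) (r * `|N (texp (letter i))|)) => c cr; split.
    apply: graded_bound_le (graded_bound_dil cr hC') => //.
    by rewrite le_max lexx.
  rewrite /= Nd; last exact: lgrp_letter.
  rewrite le_max; apply/orP; right.
  apply: le_trans (ler_norm _) _.
  by rewrite normrM normr_id ler_wpM2r.
have [C1 h1] := graded_bound_ex (texp (letter i) : T).
have [C2 h2] := graded_bound_ex (tinv (texp (letter i)) : T).
have [C3 h3] := @graded_boundV R d m C.
pose C4 := m.+1%:R * (m.+1%:R * (m.+1%:R * (C1 * C) * C2) * C3).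
pose C5 := N (texp (letter i)) + C + N (texp (letter i)) + C.
exists (Num.max C4 C5) => c /IHs[hb hN]; rewrite gbracket_cons; split.
  apply: (@graded_bound_le _ _ _ C4) => //; first by rewrite le_max lexx.
  exact: graded_boundM ler01 (graded_boundM ler01 (graded_boundM ler01 h1 hb) h2)
    (h3 _ _ ler01 hb).
rewrite le_max; apply/orP; right.
have Lx := lgrp_letter (R := R) (d := d) (m := m) i.
have Ly := lgrp_gbracket m_gt0 (j :: s) c.
have Lx' := lgrpV m_gt0 Lx; have Ly' := lgrpV m_gt0 Ly.
apply: le_trans (NM _ _ _ Ly') _; first by do !apply: lgrpM => //.
rewrite [N (tinv (gbracket _ _))]NV //; apply: lerD => //.
apply: le_trans (NM _ _ _ Lx') _; first by apply: lgrpM.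
rewrite [N (tinv _)]NV //; apply: lerD => //.
by apply: le_trans (NM _ _ Lx Ly) _; rewrite lerD2l.
Qed.

Lemma prod_gbracket_bound N (I : Type) (s : seq I) (P : pred I) (w : I -> seq 'I_d) r :
  lnorm N -> exists C, forall c : I -> R, (forall i, `|c i| <= r) ->
  graded_bound C 1 (\prod_(i <- s | P i) gbracket (w i) (c i) : T) /\
  N (\prod_(i <- s | P i) gbracket (w i) (c i)) <= C.
Proof.
move=> hN; have [N1 Nd NM NV] := hN; elim: s => [|i s [C IHs]].
  exists 1 => c _; rewrite big_nil N1; split=> //; exact: graded_bound1.
case Pi: (P i); last by exists C => c /IHs; rewrite big_cons Pi.
have [C' hC'] := gbracket_bound (w i) r hN.
exists (Num.max (m.+1%:R * (C' * C)) (C' + C)) => c hc.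
have [hb hNb] := IHs c hc; have [hb' hNb'] := hC' _ (hc i).
rewrite big_cons Pi; split.
  apply: graded_bound_le (graded_boundM _ hb' hb) => //.
  by rewrite le_max lexx.
rewrite le_max; apply/orP; right; apply: le_trans (NM _ _ _ _) (lerD hNb' hNb).
  exact: lgrp_gbracket.
by elim/big_ind: _ => [|x y|j _]; [exact: lgrp1|exact: lgrpM|exact: lgrp_gbracket].
Qed.

(** Descending induction on the order [k] of [g - 1], with [g = 1] at [k = m.+1]. A product [h] of
    elements [gbracket], with bounded coefficients, has the same degree [k] part as [g], so
    [tinv h * g] has order [k.+1]. It satisfies another coordinate bound, whence [r] is left general
    in the induction. *)
Lemma lnorm_bound_deg N j k : (0 < k)%N -> (j + k = m.+1)%N -> lnorm N ->
  forall r, exists C, forall g, lgrp g -> deg_ge k (g - 1) ->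
    graded_bound r 1 g -> N g <= C.
Proof.
move=> k0 jk hN; have [N1 Nd NM NV] := hN; elim: j k k0 jk => [|j IHj] k k0 jk r.
  exists 0 => g _; rewrite -[k]add0n jk => /deg_ge_full/eqP.
  by rewrite subr_eq0 => /eqP->; rewrite N1.
have [phi [M [phiE phib]]] := lie_coef.
(* The leading term of [g - 1] is bounded by [r + 1], hence its coefficients by [M * (r + 1)]. *)
have [C1 hC1] := prod_gbracket_bound (index_enum 'I_#|{: word}|)
  (fun i => size (enum_val i : word) == k) (fun i => val (enum_val i : word))
  (M * (r + 1)) hN.
have [C2 hC2] := @graded_boundV R d m C1.
have [C3 hC3] := IHj k.+1 isT (etrans (addnS j k) jk) (m.+1%:R * (C2 * r)).
exists (C1 + C3) => g Lg gk gr.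
have g1 := lgrp_nil Lg.
set z := trunc k.+1 (g - 1).
have Lz : z \in lie := lgrp_leading k0 Lg gk.
have hz : homog k z := homog_trunc gk.
have zb : graded_bound (r + 1) 1 z.
  have := graded_boundD gr (graded_boundN (graded_bound1 ler01)) => hb w.
  rewrite ffunE; case: ifP => _; first exact: hb.
  by rewrite normr0 mulr_ge0 ?expr1n // (graded_bound_ge0 hb).
have [hb hNb] := hC1 (fun i => phi i z) (fun i => phib i _ _ zb).
set h := \prod_(i <- _ | _) _ in hb hNb.
(* As [z] is homogeneous of degree [k], only brackets of words of length [k] contribute to it. *)
pose S := \sum_(i | size (enum_val i : word) == k)
   phi i z *: (rbracket (val (enum_val i : word)) : T).
have zS : z = S.
  apply/ffunP => w; have [wk|wk] := eqVneq (size w) k; last first.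
    rewrite hz // sum_ffunE big1 // => i /eqP ik.
    by rewrite tscaleE homog_rbracket ?mulr0 // ik.
  rewrite {1}(phiE _ Lz) !sum_ffunE [RHS]big_mkcond; apply: eq_bigr => i _.
  case: eqP => // /eqP ik; rewrite tscaleE homog_rbracket ?mulr0 //.
  by rewrite wk eq_sym.
have [Lh hS _] : [/\ lgrp h, deg_ge k.+1 (h - 1 - S) & deg_ge k S].
  rewrite /h /S; elim/big_rec2: _ => [|i y x ik [Lx hx hy]].
    by split; [exact: lgrp1| rewrite subrr subr0|]; exact: deg_ge0.
  set e := gbracket _ _; have Le : lgrp e by exact: lgrp_gbracket.
  have := @gbracket_leading _ _ _ m_gt0 (val (enum_val i : word)) (phi i z).
  rewrite -/e; set B := _ *: _; rewrite (eqP ik) => he.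
  have hB : deg_ge k B.
    apply: deg_geZ; rewrite -(eqP ik); apply: homog_deg_ge; exact: homog_rbracket.
  split; [exact: lgrpM| |exact: deg_geD].
  have -> : e * x - 1 - (B + y) = (e - 1 - B) + (x - 1 - y) + (e - 1) * (x - 1).
    rewrite mulrBr !mulrBl !mul1r !mulr1.
    by apply/ffunP => w; rewrite !(taddE, toppE); ring.
  apply: deg_geD; first exact: deg_geD.
  rewrite -add1n; apply: deg_geM.
    by apply/deg_ge1P; rewrite taddE toppE lgrp_nil // toneE subrr.
  by rewrite -[x - 1](subrK y); apply: deg_geD => //; exact: deg_ge_le hx.
have h1 := lgrp_nil Lh; have Lh' := lgrpV m_gt0 Lh.
have -> : g = h * (tinv h * g) by rewrite mulrA tmulV // mul1r.
apply: le_trans (NM _ _ Lh (lgrpM m_gt0 Lh' Lg)) _; apply: lerD => //.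
apply: hC3; first exact: lgrpM.
  have -> : tinv h * g - 1 = tinv h * ((g - 1 - S) - (h - 1 - S)).
    rewrite -(tmulVr h1) -mulrBr; congr (_ * _).
    by apply/ffunP => w; rewrite !(taddE, toppE); ring.
  apply: deg_ge_mull; apply: deg_geB => //; rewrite -zS; exact: deg_ge_trunc.
exact: graded_boundM (hC2 _ _ _ hb) gr.
Qed.

(** Dilating by [h^-1] reduces to [h = 1], a fixed bounded set. *)
Lemma lnorm_graded_bound N : lnorm N -> exists2 C, 0 < C & forall g h,
  lgrp g -> 0 < h -> graded_bound 1 h g -> N g <= C * h.
Proof.
move=> hN; have [N1 Nd NM NV] := hN.
have [C hC] := lnorm_bound_deg (isT : (0 < 1)%N) (addn1 m) hN 1.
exists (Num.max 1 C); first by rewrite lt_max ltr01.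
move=> g h Lg h0 gh.
have -> : g = dil h (dil h^-1 g) by rewrite dil_dil divff ?gt_eqF // dil_id.
have Lg' := lgrp_dil m_gt0 h^-1 Lg.
rewrite (Nd _ _ Lg') gtr0_norm // [leLHS]mulrC; apply: ler_wpM2r; first exact: ltW.
rewrite le_max; apply/orP; right.
apply: hC => //.
  by apply/deg_ge1P; rewrite taddE toppE lgrp_nil // toneE subrr.
move=> w; rewrite ffunE expr1n mulr1 normrM normrX gtr0_norm ?invr_gt0 //.
by rewrite exprVn mulrC ler_pdivrMr ?exprn_gt0 //; exact: gh.
Qed.

End HomogeneousNormBound.

(** * Antiderivatives on the whole line and a mean value bound *)

Section Antiderivative.
Context {R : realType}.
Local Notation mu := (@lebesgue_measure R).
Implicit Types f : R -> R.

Lemma continuous_itv_integrable f (a b : R) :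
  continuous f -> mu.-integrable `[a, b] (EFin \o f).
Proof.
move=> cf; apply: continuous_compact_integrable; first exact: segment_compact.
exact: continuous_subspaceT.
Qed.

(* The first interval is empty for [t <= 0], the second one for [0 <= t]. *)
Definition antiderivative f (t : R) : R :=
  \int[mu]_(u in `]0, t]) f u - \int[mu]_(u in `]t, 0]) f u.

Lemma antiderivative0 f : antiderivative f 0 = 0.
Proof. exact: subrr. Qed.

(** Near [t] the antiderivative differs by a constant from the integral based at [a], a point to the
    left of both [t] and 0. *)
Lemma is_derive_antiderivative f : continuous f ->
  forall t, is_derive t (1 : R) (antiderivative f) (f t).
Proof.
move=> cf t; pose a := Num.min t 0 - 1.
have at_ : a < t by rewrite /a ltrBlDr; apply: (@le_lt_trans _ _ t); rewrite ?ge_min ?lexx ?ltrDl.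
have a0 : a < 0 by rewrite /a ltrBlDr; apply: (@le_lt_trans _ _ 0); rewrite ?ge_min ?lexx ?orbT ?ltrDl.
pose G s := \int[mu]_(u in `[a, s]) f u.
have GB s s' : a <= s -> s <= s' -> G s' - G s = \int[mu]_(u in `]s, s']) f u.
  move=> as_ ss'; rewrite /G Rintegral_itvB ?bnd_simp //.
  exact: continuous_itv_integrable.
have FG s : a <= s -> antiderivative f s = G s - G 0.
  move=> as_; rewrite /antiderivative; have [s0|/ltW s0] := leP s 0.
    rewrite set_itv_ge ?bnd_simp -?leNgt // Rintegral_set0 sub0r -GB //.
    by rewrite opprB.
  rewrite [X in _ - X](_ : _ = 0) ?subr0; first by rewrite GB // ltW.
  by rewrite set_itv_ge ?bnd_simp -?leNgt // Rintegral_set0.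
have [dG G'] : derivable G t 1 /\ derive1 G t = f t.
  apply: (@continuous_FTC1_closed _ f a t (t + 1)) => //; first by rewrite ltrDl.
    exact: continuous_itv_integrable.
  exact: cf.
apply: (@near_eq_is_derive _ _ _ (fun s => G s - G 0)).
  have : \forall s \near t, - s < - a by apply: Nlt_nbhsl; rewrite ltrN2.
  by apply: filterS => s; rewrite ltrN2 => /ltW/FG ->.
rewrite -G' derive1E -[X in is_derive _ _ _ X]subr0.
apply: is_deriveB; exact: derivableP.
Qed.

Lemma is_derive_continuous f (df : R -> R) :
  (forall t, is_derive t (1 : R) f (df t)) -> continuous f.
Proof.
move=> h t; apply/differentiable_continuous/derivable1_diffP.
by have [] := h t.
Qed.

Lemma MVT_norm_le f (df : R -> R) (a b C : R) : a <= b ->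
  (forall t, is_derive t (1 : R) f (df t)) ->
  (forall t, a <= t <= b -> `|df t| <= C) -> `|f b - f a| <= C * (b - a).
Proof.
move=> ab h hC.
have [|c /[!in_itv]/= cab ->] := @MVT_segment R f df a b ab (fun t _ => h t).
  exact/continuous_subspaceT/(is_derive_continuous h).
by rewrite normrM [X in _ * X]ger0_norm ?subr_ge0 // ler_wpM2r ?subr_ge0 ?hC.
Qed.

End Antiderivative.

(** * Signatures as solutions of a linear equation, and their dependence on the velocity *)

Section ControlledCurve.
Context {R : realType} {d m : nat}.
Local Notation word := (m.-bseq 'I_d).
Local Notation T := (ttensor R d m).
Implicit Types f g : 'I_d -> R -> R.

Definition velocity f (t : R) : T :=
  [ffun w : word => if w : seq 'I_d is [:: i] then f i t else (0 : R)].

Lemma velocityM f t (a : T) (w : word) : (velocity f t * a) w =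
  if w : seq 'I_d is i :: _ then f i t * a (drop_word 1 w) else 0.
Proof.
rewrite tmulE; case: w => -[|i w] /= wm.
  by rewrite big_ord1 ffunE /= mul0r.
rewrite big_ord_recl big_ord_recl ffunE /= mul0r add0r ffunE /= take0 big1 ?addr0 //.
move=> k _; rewrite ffunE /=; case: w wm k => [|j w] wm k; first by case: k.
by rewrite mul0r.
Qed.

Lemma lie_velocity f t : velocity f t \in lie.
Proof.
have -> : velocity f t = \sum_i f i t *: letter i.
  apply/ffunP => w; rewrite sum_ffunE ffunE.
  case: w => -[|i [|j w]] /= wm.
  - by rewrite big1 // => i _; rewrite !ffunE scaler0.
  - rewrite (bigD1 i) //= big1 ?addr0 => [|j ji]; rewrite tscaleE ffunE /=.
      by rewrite eqxx mulr1.
    by rewrite eqseq_cons andbT eq_sym (negPf ji) mulr0.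
  - by rewrite big1 // => k _; rewrite tscaleE ffunE /= eqseq_cons andbF mulr0.
by apply: memv_suml => i _; rewrite memvZ ?lie_letter.
Qed.

(* The solution of [P' = - velocity f * P], [P 0 = 1]; then [P s * P t ^-1] is
   the signature over [s, t]. *)
Fixpoint curve_coord f (w : seq 'I_d) : R -> R :=
  if w is i :: w' then antiderivative (fun u => - (f i u * curve_coord f w' u))
  else fun=> 1.

Definition curve f (t : R) : T := [ffun w : word => curve_coord f w t].

Lemma curve_coord_continuous f w :
  (forall i, continuous (f i)) -> continuous (curve_coord f w).
Proof.
move=> cf; elim: w => [|i w IHw] /=; first by move=> x; exact: cst_continuous.
apply: is_derive_continuous; apply: is_derive_antiderivative => x.
by apply: cvgN; apply: cvgM; [exact: cf | exact: IHw].
Qed.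

Lemma curve0 f : curve f 0 = 1.
Proof.
apply/ffunP => w; rewrite ffunE toneE; case: w => -[|i w] //= _.
exact: antiderivative0.
Qed.

Lemma tder_curve f : (forall i, continuous (f i)) ->
  tder (curve f) (fun t => - velocity f t * curve f t).
Proof.
move=> cf t w; rewrite mulNr toppE velocityM.
rewrite (_ : (fun _ => _) = curve_coord f w); last by apply/funext => s; rewrite ffunE.
case: w => -[|i w] /= wm; first by rewrite oppr0; exact: is_derive_cst.
rewrite ffunE /= drop0; apply: is_derive_antiderivative => x.
by apply: cvgN; apply: cvgM; [exact: cf | exact: curve_coord_continuous].
Qed.

Lemma lgrp_curve f t : (forall i, continuous (f i)) -> lgrp (curve f t).
Proof.
move=> cf; apply: (@lgrp_ode _ _ _ (fun t => - velocity f t) (curve f) 0).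
- by move=> s; rewrite memvN lie_velocity.
- exact: tder_curve.
- by rewrite curve0; exact: lgrp1.
Qed.

Definition transport f (s t : R) : T := curve f s * tinv (curve f t).

Lemma transport_id f t : (forall i, continuous (f i)) -> transport f t t = 1.
Proof. by move=> cf; rewrite /transport tmulV // lgrp_nil //; exact: lgrp_curve. Qed.

Lemma tder_transport f t : (forall i, continuous (f i)) ->
  tder (transport f ^~ t) (fun s => - velocity f s * transport f s t).
Proof.
move=> cf; apply: tder_eq (tderM (tder_curve cf) (tder_cst (tinv (curve f t)))) _.
by move=> s; rewrite mulr0 addr0 mulrA.
Qed.

Lemma lgrp_transport f s t : (0 < m)%N -> (forall i, continuous (f i)) ->
  lgrp (transport f s t).
Proof.
by move=> m0 cf; apply: lgrpM => //; [|apply: lgrpV => //]; exact: lgrp_curve.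
Qed.

Lemma is_derive_transport f t (w : word) : (forall i, continuous (f i)) ->
  forall s, is_derive s (1 : R) (fun s => transport f s t w)
    (- (if w : seq 'I_d is i :: _ then f i s * transport f s t (drop_word 1 w) else 0)).
Proof. by move=> cf s; rewrite -velocityM -toppE -mulNr; exact: tder_transport. Qed.

Lemma transport_nil f s t : (forall i, continuous (f i)) -> transport f s t [bseq] = 1.
Proof.
move=> cf.
by rewrite /transport tmul_nil tinv_nil ?mulr1 ?lgrp_nil //; exact: lgrp_curve.
Qed.

Section Bounds.
Variables (f g : 'I_d -> R -> R) (M delta s t : R).
Hypotheses (cf : forall i, continuous (f i)) (cg : forall i, continuous (g i)).
Hypotheses (M_ge1 : 1 <= M) (st : s <= t).
Hypothesis fM : forall i u, s <= u <= t -> `|f i u| <= M.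
Hypothesis gM : forall i u, s <= u <= t -> `|g i u| <= M.
Hypothesis fg : forall i u, s <= u <= t -> `|f i u - g i u| <= delta.

Let h := t - s.
Let h_ge0 : 0 <= h. Proof. by rewrite subr_ge0. Qed.
Let M_ge0 : 0 <= M. Proof. exact: le_trans ler01 M_ge1. Qed.

(** Induction on the word: the derivative in [u] at the word [i :: w] is, up to sign, [f i] times
    the coordinate at [w]. The mean value bound is applied on [[u, t]], since a coordinate of
    positive degree vanishes at [u = t]. *)
Lemma transport_bound n (w : word) u : size w = n -> s <= u <= t ->
  `|transport f u t w| <= (M * h) ^+ n.
Proof.
elim: n w u => [|n IHn] w u wn ust.
  rewrite (_ : w = [bseq]) ?transport_nil // ?normr1 //.
  by apply: val_inj; exact: size0nil.
have ut : u <= t by case/andP: ust.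
have H := MVT_norm_le (C := M * (M * h) ^+ n) ut (is_derive_transport t w cf).
have {H} := H _; rewrite transport_id // toneE wn /= sub0r normrN => H.
apply: le_trans (H _) _; last first.
  rewrite exprSr mulrA [M * (M * h) ^+ n]mulrC; apply: ler_wpM2l.
    by rewrite mulr_ge0 // exprn_ge0 // mulr_ge0.
  by rewrite lerD2l lerN2; case/andP: ust.
move=> v /andP[uv vt]; rewrite normrN.
have svt : s <= v <= t by rewrite vt (le_trans _ uv) //; case/andP: ust.
case: w wn {H} => -[|i w] //= wm [wn]; rewrite normrM ler_pM // ?fM //.
by apply: IHn; rewrite //= drop0.
Qed.

Lemma transport_close n (w : word) u : size w = n -> s <= u <= t ->
  `|transport f u t w - transport g u t w| <= n%:R * delta * (M * h) ^+ n.
Proof.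
elim: n w u => [|n IHn] w u wn ust.
  rewrite (_ : w = [bseq]) ?transport_nil // ?subrr ?normr0 ?mul0r //.
  by apply: val_inj; exact: size0nil.
have ut : u <= t by case/andP: ust.
pose D v := - (if w : seq 'I_d is i :: _
   then f i v * transport f v t (drop_word 1 w) else 0)
  - - (if w : seq 'I_d is i :: _ then g i v * transport g v t (drop_word 1 w) else 0).
have dD v : is_derive v (1 : R) (fun v => transport f v t w - transport g v t w) (D v).
  apply: is_deriveB; exact: is_derive_transport.
have H := MVT_norm_le (C := n.+1%:R * delta * M * (M * h) ^+ n) ut dD.
have {H} := H _; rewrite !transport_id // subrr sub0r normrN => H.
have delta0 : 0 <= delta.
  case: w wn {D dD H} => -[|i w] //= wm _; exact: le_trans (normr_ge0 _) (fg i ust).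
apply: le_trans (H _) _; last first.
  rewrite exprS -!mulrA; do 3![apply: ler_wpM2l => //].
  rewrite [leLHS]mulrC; apply: ler_wpM2r; first by rewrite exprn_ge0 // mulr_ge0.
  by rewrite lerD2l lerN2; case/andP: ust.
move=> v /andP[uv vt]; rewrite /D.
have svt : s <= v <= t by rewrite vt (le_trans _ uv) //; case/andP: ust.
case: w wn {D dD H} => -[|i w] //= wm [wn].
set w' := drop_word _ _; have w'n : size w' = n by rewrite /= drop0.
have Hf := transport_bound w'n svt; have Hfg := IHn _ _ w'n svt.
move: (transport f v t w') (transport g v t w') Hf Hfg => a b Hf Hfg.
(* The error splits into that of the velocities, with factor [a], and that of the shorter word, with
   factor [g i v]. *)
have -> : - (f i v * a) - - (g i v * b) = - ((f i v - g i v) * a + g i v * (a - b)).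
  by ring.
rewrite normrN; apply: le_trans (ler_normD _ _) _; rewrite !normrM.
have H1 : `|f i v - g i v| * `|a| <= delta * (M * h) ^+ n by rewrite ler_pM ?fg.
have H2 : `|g i v| * `|a - b| <= M * (n%:R * delta * (M * h) ^+ n) by rewrite ler_pM ?gM.
apply: le_trans (lerD H1 H2) _.
have X0 : 0 <= (M * h) ^+ n by rewrite exprn_ge0 // mulr_ge0.
(* With [1 <= M], the velocity error adds one more [delta * M] to the [n] already present. *)
have H3 : delta <= delta * M by rewrite ler_peMr.
rewrite -natr1; have -> : delta * (M * h) ^+ n + M * (n%:R * delta * (M * h) ^+ n) =
  (delta + n%:R * delta * M) * (M * h) ^+ n by ring.
apply: ler_wpM2r => //; rewrite !mulrDl mul1r.
by rewrite addrC lerD2l.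
Qed.

End Bounds.

End ControlledCurve.

(** Since [tinv P * Q = 1 + tinv P * (Q - P)], its coordinates of degree [k > 0] are at most
    [B * delta * (t - s) ^+ k]. For small [delta] this is below [(eps * (t - s)) ^+ k], and
    [lnorm_graded_bound] gives a bound linear in [t - s]. *)
Lemma lnorm_transport_close (R : realType) (d m : nat)
    (N : ttensor R d m -> R) (M e : R) :
  (0 < m)%N -> lnorm N -> 1 <= M -> 0 < e -> exists2 delta, 0 < delta &
  forall f g : 'I_d -> R -> R,
  (forall i, continuous (f i)) -> (forall i, continuous (g i)) ->
  (forall i u, 0 <= u <= 1 -> `|f i u| <= M) ->
  (forall i u, 0 <= u <= 1 -> `|g i u| <= M) ->
  (forall i u, 0 <= u <= 1 -> `|f i u - g i u| <= delta) ->
  forall s t, 0 <= s -> s < t -> t <= 1 ->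
  N (tinv (transport f s t) * transport g s t) <= e * (t - s).
Proof.
move=> m0 hN M1 e0.
have M0 : 0 <= M := le_trans ler01 M1.
have [C C0 hC] := lnorm_graded_bound m0 hN.
have [CV hCV] := @graded_boundV R d m (M ^+ m).
(* The bound [eps <= 1] makes [eps ^+ m] the smallest of the powers involved; [eps <= e / C] absorbs
   the constant of the norm. *)
pose eps := Num.min 1 (e / C).
have eps0 : 0 < eps by rewrite lt_min ltr01 divr_gt0.
have eps1 : eps <= 1 by rewrite ge_min lexx.
pose B := m.+1%:R * (`|CV| * (m%:R * M ^+ m)).
have B0 : 0 <= B by rewrite !mulr_ge0 ?exprn_ge0.
exists (eps ^+ m / (1 + B)); first by rewrite divr_gt0 ?exprn_gt0 // ltr_pwDl.
move=> f g cf cg fM gM fg s t s0 st t1.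
set delta := _ / _ in fg.
have [deltaE delta0] : delta = eps ^+ m / (1 + B) /\ 0 <= delta.
  by split=> //; rewrite divr_ge0 ?exprn_ge0 ?addr_ge0 // ltW.
clearbody delta.
have h0 : 0 < t - s by rewrite subr_gt0.
have in01 u : s <= u <= t -> 0 <= u <= 1.
  by move=> /andP[su ut]; rewrite (le_trans s0 su) (le_trans ut t1).
have sst : s <= s <= t by rewrite lexx ltW.
have fM' i u : s <= u <= t -> `|f i u| <= M by move/in01; exact: fM.
have gM' i u : s <= u <= t -> `|g i u| <= M by move/in01; exact: gM.
have fg' i u : s <= u <= t -> `|f i u - g i u| <= delta by move/in01; exact: fg.
have Mm (w : m.-bseq 'I_d) : M ^+ size w <= M ^+ m by rewrite ler_weXn2l // size_bseq.
set P := transport f s t; set Q := transport g s t.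
have hP : graded_bound (M ^+ m) (t - s) P.
  move=> w; apply: le_trans (transport_bound cf M1 (ltW st) fM' erefl sst) _.
  by rewrite exprMn ler_wpM2r // exprn_ge0 // ltW.
have hPQ : graded_bound (delta * (m%:R * M ^+ m)) (t - s) (Q - P).
  move=> w; rewrite taddE toppE distrC.
  apply: le_trans (transport_close cf cg M1 (ltW st) fM' gM' fg' erefl sst) _.
  rewrite exprMn [leLHS](_ : _ =
    delta * ((size w)%:R * M ^+ size w) * (t - s) ^+ size w); last by ring.
  apply: ler_wpM2r; first by rewrite exprn_ge0 // ltW.
  by apply: ler_wpM2l => //; rewrite ler_pM ?exprn_ge0 // ler_nat size_bseq.
have LP : lgrp P by exact: lgrp_transport.
have LQ : lgrp Q by exact: lgrp_transport.
have LPQ : lgrp (tinv P * Q) by apply: lgrpM => //; exact: lgrpV.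
have PQE : tinv P * Q = 1 + tinv P * (Q - P).
  by rewrite mulrBr tmulVr ?lgrp_nil // addrC subrK.
have hdiff := graded_boundM (ltW h0) (hCV _ _ (ltW h0) hP) hPQ.
apply: le_trans (hC _ (eps * (t - s)) LPQ (mulr_gt0 eps0 h0) _) _; last first.
  rewrite mulrA ler_wpM2r ?(ltW h0) // mulrC -ler_pdivlMr //.
  by rewrite ge_min lexx orbT.
(* The scalar component is exactly 1; smallness is needed in positive degree only. *)
move=> w; rewrite mul1r; have [w0|w0] := posnP (size w).
  rewrite (_ : w = [bseq]) ?(lgrp_nil LPQ) ?normr1 //.
  by apply: val_inj; exact: size0nil.
rewrite PQE taddE toneE gtn_eqF // add0r; apply: le_trans (hdiff w) _.
rewrite exprMn; apply: ler_wpM2r; first by rewrite exprn_ge0 // ltW.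
apply: (@le_trans _ _ (eps ^+ m)); last first.
  exact: ler_wiXn2l (ltW eps0) eps1 _ _ (size_bseq w).
apply: (@le_trans _ _ (B * delta)).
  rewrite /B -!mulrA; apply: ler_wpM2l => //.
  have X0 : 0 <= delta * (m%:R * M ^+ m) by apply: mulr_ge0 => //; apply: mulr_ge0 => //; exact: exprn_ge0.
  by apply: le_trans (ler_wpM2r X0 (ler_norm CV)) _; rewrite [leLHS](_ : _ =
    `|CV| * (m%:R * (M ^+ m * delta))) //; ring.
rewrite deltaE mulrCA; apply: ler_piMr; first by rewrite exprn_ge0 // ltW.
by rewrite ler_pdivrMr ?mul1r ?ltr_pwDl // lerDr.
Qed.

(** * The group over [V] in coordinates *)

Section LieGroupOfV.
Context {R : realType} {V : finNormedModType R} {m : nat}.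
Local Notation n := (\dim (fullv : {vspace V})).
Local Notation T := (ttensor R n m).

Lemma vcoord_basis (i j : 'I_n) : vcoord i (vbasis fullv)`_j = (i == j)%:R.
Proof. by rewrite /vcoord coord_free ?(basis_free (vbasisP _)) // eq_sym. Qed.

Lemma tvec_basis (i : 'I_n) : (tvec (vbasis fullv)`_i : tensor_of V m) = letter i :> T.
Proof.
apply/ffunP => w; rewrite !ffunE; case: w => -[|j [|k w]] //= wm.
  by rewrite vcoord_basis eqseq_cons andbT.
by rewrite eqseq_cons andbF.
Qed.

Lemma tvec_letters (v : V) :
  (tvec v : tensor_of V m) = \sum_i vcoord i v *: (letter i : T) :> T.
Proof.
apply/ffunP => w; rewrite sum_ffunE ffunE.
case: w => -[|i [|j w]] /= wm.
- by rewrite big1 // => i _; rewrite !ffunE scaler0.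
- rewrite (bigD1 i) //= big1 ?addr0 => [|j ji]; rewrite tscaleE ffunE /=.
    by rewrite eqxx mulr1.
  by rewrite eqseq_cons andbT eq_sym (negPf ji) mulr0.
- by rewrite big1 // => k _; rewrite tscaleE ffunE /= eqseq_cons andbF mulr0.
Qed.

(** The letters are the images of the basis vectors, and [lie] is closed under brackets. *)
Lemma lie_genP (a : T) : lie_gen (a : tensor_of V m) <-> a \in lie.
Proof.
split.
  elim=> [v|c {}a b _ ha _ hb|{}a b _ ha _ hb].
  - by rewrite tvec_letters; apply: memv_suml => i _; rewrite memvZ ?lie_letter.
  - by apply: (@memvD _ T) => //; apply: memvZ.
  - exact: lie_bracket ha hb.
have l0 : lie_gen (0 : tensor_of V m).
  by have := lie_gen_lin (-1) (@lie_gen_vec R V m 0) (@lie_gen_vec R V m 0); rewrite scaleN1r addNr.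
move: a; apply: lie_ind => //.
  by move=> c a b; exact: (@lie_gen_lin R V m).
elim=> [|i [|j s] IHs] //.
  by rewrite /= -tvec_basis; exact: lie_gen_vec.
rewrite rbracket_cons; apply: (@lie_gen_bracket R V m) => //.
by rewrite -tvec_basis; exact: lie_gen_vec.
Qed.

Lemma GmP (g : T) : (0 < m)%N -> Gm (g : tensor_of V m) <-> lgrp g.
Proof.
move=> m0; split=> [[a /lie_genP La <-]|/(lgrp_exp m0)[a La ->]]; first exact: lgrp_texp.
by exists a => //; exact/lie_genP.
Qed.

Lemma homogeneous_norm_lnorm (N : tensor_of V m -> R) : (0 < m)%N ->
  homogeneous_norm N -> lnorm (N : T -> R).
Proof.
move=> m0 [_ N0 Nd NM NV]; split.
- by apply/N0 => //; apply/(GmP _ m0); exact: lgrp1.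
- by move=> t g /(GmP _ m0)/Nd.
- by move=> g h /(GmP _ m0) Gg /(GmP _ m0) Gh; exact: NM.
- by move=> g /(GmP _ m0)/NV.
Qed.

End LieGroupOfV.

(** * Continuity of the coordinates of [V] *)

Section VcoordContinuous.
Context {R : realType} {V : finNormedModType R}.
Local Notation n := (\dim (fullv : {vspace V})).

Let of_coord (c : 'rV[R]_n) : V := \sum_i c ord0 i *: (vbasis fullv)`_i.
Let to_coord (v : V) : 'rV[R]_n := \row_i vcoord i v.

Let to_coordK v : of_coord (to_coord v) = v.
Proof.
rewrite /of_coord [RHS](coord_vbasis (memvf v)).
by apply: eq_bigr => i _; rewrite mxE.
Qed.

Let of_coordZ a c : of_coord (a *: c) = a *: of_coord c.
Proof. by rewrite /of_coord scaler_sumr; apply: eq_bigr => i _; rewrite mxE scalerA. Qed.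

Let of_coord_eq0 c : of_coord c = 0 -> c = 0.
Proof.
move=> c0; apply/rowP => i; rewrite mxE.
have /freeP := basis_free (vbasisP (fullv : {vspace V})).
by apply; exact: c0.
Qed.

Let of_coord_continuous : continuous (fun c => `|of_coord c|).
Proof.
have sumC (s : seq 'I_n) :
    continuous (fun a : 'rV[R]_n => \sum_(i <- s) a ord0 i *: (vbasis fullv)`_i : V).
  elim: s => [|i s IHs].
    by under eq_fun do rewrite big_nil; move=> c; exact: cst_continuous.
  have Hi : continuous (fun a : 'rV[R]_n => a ord0 i *: (vbasis fullv)`_i : V).
    move=> c; have Hc := @coord_continuous R 1 n ord0 i c.
    exact: (cvgZr_tmp Hc).
  under eq_fun do rewrite big_cons.
  by move=> c; exact: (cvgD (Hi c) (IHs c)).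
move=> c; apply: (@continuous_comp _ _ _ of_coord Num.norm); last exact: norm_continuous.
exact: (sumC (index_enum _)).
Qed.

Let normalize (c : 'rV[R]_n) : c != 0 -> `| `|c|^-1 *: c| = 1.
Proof. by move=> c0; rewrite normrZ normfV normr_id mulVf // normr_eq0. Qed.

Let coord_le_norm (c : 'rV[R]_n) i : `|c ord0 i| <= `|c|.
Proof.
by rewrite [leRHS]/Num.norm /= mx_normrE; apply/bigmax_geP; right => /=; exists (ord0, i).
Qed.

(** The norm of [V], read in coordinates, attains a positive minimum on the compact unit sphere;
    homogeneity does the rest. *)
Lemma vcoord_le_norm : exists2 K : R, 0 < K & forall i (v : V), `|vcoord i v| <= K * `|v|.
Proof.
have coordE i v : vcoord i v = to_coord v ord0 i by rewrite mxE.
(* Without a unit vector, every coordinate vector is 0. *)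
have [[c0 c01]|/forallNP S0] := pselect (exists c : 'rV[R]_n, `|c| = 1); last first.
  exists 1 => // i v; rewrite coordE.
  have [->|/normalize/S0 //] := eqVneq (to_coord v) 0.
  by rewrite mxE normr0 mul1r.
have cS : compact [set c : 'rV[R]_n | `|c| = 1].
  apply: bounded_closed_compact.
    by exists 1; split=> // M M1 c /= ->; exact: ltW.
  apply: (@closed_comp _ _ (Num.norm : 'rV[R]_n -> R) [set x | x = 1]).
    by move=> x _; exact: norm_continuous.
  exact: closed_eq.
have [c /= c1 cmin] := EVT_min_rV (ex_intro _ c0 c01) cS
  (continuous_subspaceT of_coord_continuous).
have mu0 : 0 < `|of_coord c|.
  rewrite normr_gt0; apply/eqP => /of_coord_eq0 c00.
  by move: c1; rewrite inE /= c00 normr0 => /esym/eqP; rewrite oner_eq0.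
exists (`|of_coord c|^-1); first by rewrite invr_gt0.
move=> i v; rewrite coordE; apply: le_trans (coord_le_norm _ _) _.
have [->|v0] := eqVneq (to_coord v) 0.
  by rewrite normr0 mulr_ge0 // invr_ge0.
have := cmin (`|to_coord v|^-1 *: to_coord v); rewrite inE /= normalize // => /(_ erefl).
rewrite of_coordZ to_coordK normrZ normfV normr_id => H.
by rewrite mulrC ler_pdivlMr // mulrC -ler_pdivlMr ?normr_gt0 // mulrC.
Qed.

Lemma vcoord_continuous i : continuous (@vcoord R V i).
Proof.
have [K K0 hK] := vcoord_le_norm.
move=> v; apply/cvgrPdist_lt => e e0; near=> u.
rewrite /vcoord -linearB; apply: le_lt_trans (hK i _) _.
rewrite mulrC -ltr_pdivlMr //; near: u.
by apply: cvgr_dist_lt; rewrite ?divr_gt0.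
Unshelve. all: by end_near. Qed.

End VcoordContinuous.

(** * Signatures of smooth paths *)

Section SignatureOfSmoothPath.
Context {R : realType} {V : finNormedModType R} {m : nat}.
Local Notation n := (\dim (fullv : {vspace V})).
Local Notation T := (ttensor R n m).

Definition path_velocity (x : R -> V) (i : 'I_n) (u : R) : R := vcoord i (derive1 x u).

Lemma path_velocity_continuous x i : smooth x -> continuous (path_velocity x i).
Proof.
move=> sx u; apply: (@continuous_comp _ _ _ (derive1 x) (vcoord i)).
  apply/differentiable_continuous/derivable1_diffP.
  exact: (sx 1%N u).
exact: vcoord_continuous.
Qed.

Lemma continuous_Rintegral_FTC2 (f F : R -> R) (a b : R) : a <= b -> continuous f ->
  (forall t, is_derive t (1 : R) F (f t)) ->
  \int[@lebesgue_measure R]_(u in `[a, b]) f u = F b - F a.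
Proof.
move=> ab cf dF; case: ltgtP ab => // [ab _|-> _]; last first.
  by rewrite set_itv1 Rintegral_set1 subrr.
rewrite /Rintegral (continuous_FTC2 ab (F := F)) //.
- exact: continuous_subspaceT.
- split.
  + by move=> t _; have [] := dF t.
  + exact/cvg_at_right_filter/(is_derive_continuous dF).
  + exact/cvg_at_left_filter/(is_derive_continuous dF).
- by move=> t _; rewrite derive1E; apply: derive_val.
Qed.

(** Induction on the word: the opposite of the transport coordinate is a primitive of the outermost
    integrand and vanishes at the right end. *)
Lemma iterated_integral_transport x (w : m.-bseq 'I_n) s t :
  (forall i, continuous (path_velocity x i)) -> s <= t ->
  iterated_integral x w s t = transport (path_velocity x) s t w.
Proof.
move=> cf; case: w => w; elim: w s => [|i w IHw] s wm st.
  by rewrite (_ : Bseq wm = [bseq]) ?transport_nil //; apply: val_inj.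
have wm' : (size w <= m)%N by exact: leq_trans wm.
have dropE : drop_word 1 (Bseq wm) = Bseq wm' by apply: val_inj; rewrite /= drop0.
pose F u := - transport (path_velocity x) u t (Bseq wm).
pose f u := path_velocity x i u * transport (path_velocity x) u t (Bseq wm').
have dT (v : m.-bseq 'I_n) u := is_derive_transport t v cf u.
have dF u : is_derive u (1 : R) F (f u).
  have := is_deriveN (dT (Bseq wm) u).
  by rewrite opprK /= dropE.
have cont_f : continuous f.
  move=> u; apply: cvgM; first exact: cf.
  exact: (is_derive_continuous (dT (Bseq wm'))).
transitivity (\int[@lebesgue_measure R]_(u in `[s, t]) f u).
  apply: eq_Rintegral => u; rewrite inE /= in_itv /= => /andP[_ ut].
  by rewrite /f /= -(IHw _ wm').
rewrite (continuous_Rintegral_FTC2 st cont_f dF) /F transport_id // toneE /=.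
by rewrite oppr0 opprK add0r.
Qed.

Lemma signature_transport x s t : smooth x -> s <= t ->
  (signature x s t : tensor_of V m) = transport (path_velocity x) s t :> T.
Proof.
move=> sx st; apply/ffunP => w; rewrite ffunE iterated_integral_transport //.
by move=> i; exact: path_velocity_continuous.
Qed.

Lemma tinvK (g : T) : g [bseq] = 1 -> tinv (tinv g) = g.
Proof. by move=> g1; rewrite -(@tinv_uniq _ _ _ (tinv g) g) ?tinv_nil ?tmulV. Qed.

(** From [curve f 0 = 1], the lift at [s] is [tinv (curve f s)], so increments telescope; this is
    Chen's relation. *)
Lemma incr_signature x s t : smooth x -> 0 <= s -> s <= t ->
  incr (signature_path x : R -> tensor_of V m) s t =
  transport (path_velocity x) s t :> T.
Proof.
move=> sx s0 st; have cf i : continuous (path_velocity x i) by exact: path_velocity_continuous.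
rewrite /incr /signature_path !signature_transport // ?(le_trans s0) //.
rewrite /transport curve0 !mul1r tinvK // lgrp_nil //; exact: lgrp_curve.
Qed.

End SignatureOfSmoothPath.

(** The last distance is reversed by symmetry, because both approximation distances are measured
    from an element of [C0] to a lift. *)
Lemma lnorm_quadrangle (R : realType) (d m : nat) (N : ttensor R d m -> R)
    (a c c' b : ttensor R d m) :
  (0 < m)%N -> lnorm N -> lgrp a -> lgrp c -> lgrp c' -> lgrp b ->
  N (tinv a * b) <= N (tinv a * c) + N (tinv c * c') + N (tinv b * c').
Proof.
move=> m0 [_ _ NM NV] La Lc Lc' Lb.
have LV (g : ttensor R d m) : lgrp g -> lgrp (tinv g) := lgrpV m0 (g:=g).
have LM (g h : ttensor R d m) : lgrp g -> lgrp h -> lgrp (g * h) := lgrpM m0 (g:=g) (h:=h).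
have Lbc := LM _ _ (LV _ Lb) Lc'.
have -> : N (tinv b * c') = N (tinv c' * b).
  rewrite -(NV _ Lbc); congr N; apply/esym/tinv_uniq; first exact: lgrp_nil.
  by rewrite mulrA -(mulrA (tinv c')) tmulV ?mulr1 ?tmulVr //; exact: lgrp_nil.
have -> : tinv a * b = tinv a * c * (tinv c * c') * (tinv c' * b).
  rewrite !mulrA -(mulrA (tinv a)) tmulV ?mulr1; last exact: lgrp_nil.
  by rewrite -(mulrA (tinv a)) tmulV ?mulr1 //; exact: lgrp_nil.
have Lac := LM _ _ (LV _ La) Lc; have Lcc := LM _ _ (LV _ Lc) Lc'.
have Lcb := LM _ _ (LV _ Lc') Lb.
apply: le_trans (NM _ _ (LM _ _ Lac Lcc) Lcb) _.
by rewrite lerD2r; exact: NM.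
Qed.

(** * Countable codes for continuous velocities *)

Section Separability.
Context {R : realType}.

Lemma near_inv_lt (e : R) : 0 < e -> \forall k \near \oo, (k.+1%:R : R)^-1 < e.
Proof.
move=> e0; exists (Num.truncn e^-1) => // k /= hk.
rewrite invf_plt ?posrE //; apply: lt_le_trans (truncnS_gt _) _.
by rewrite ler_nat ltnS.
Qed.

Lemma exists_inv_le (e : R) : 0 < e -> exists k : nat, (k.+1%:R : R)^-1 <= e.
Proof. by move/near_inv_lt => [k _ /(_ k (leqnn k))/ltW h]; exists k. Qed.

(** Compactness of [[0, 1]] in covering form; [v] may leave the interval. *)
Lemma unif_continuous01 (f : R -> R) (e : R) : continuous f -> 0 < e ->
  \forall k \near \oo, forall u, 0 <= u <= 1 ->
  forall v, `|u - v| <= (k.+1%:R)^-1 -> `|f u - f v| <= e.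
Proof.
move=> cf e0; pose P (k : nat) u := forall v : R, `|u - v| <= (k.+1%:R)^-1 -> `|f u - f v| <= e.
have K : compact `[(0 : R), 1] by exact: segment_compact.
have /(_ _ _ P) H := (compact_near_coveringP _).1 K.
suff : \forall k \near \oo, `[(0 : R), 1] `<=` P k.
  by apply: filterS => k hk u u01; apply: hk; rewrite /= in_itv.
apply: H => x _.
have /nbhs_ballP[r /= r0 hr] : \forall y \near x, `|f x - f y| < e / 2.
  by have /cvgrPdist_lt := cf x; apply; rewrite divr_gt0.
have r20 : 0 < r / 2 by rewrite divr_gt0.
near=> x' k => /= v vx'.
have h1 : `|x - x'| < r / 2.
  near: x'; apply/nbhs_ballP; exists (r / 2) => // y; exact.
have h2 : `|x - v| < r.
  rewrite -(subrK x' x) -addrA [r]splitr; apply: le_lt_trans (ler_normD _ _) _.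
  apply: ltrD => //; apply: le_lt_trans vx' _.
  by near: k; exact: near_inv_lt.
have h3 := hr x' (lt_trans h1 _); have h4 := hr v h2.
rewrite -(subrK (f x) (f x')) -addrA [e]splitr; apply: le_trans (ler_normD _ _) _.
rewrite distrC; apply: lerD; apply: ltW => //; apply: h3.
by rewrite ltr_pdivrMr // ltr_pMr // ltr1n.
Unshelve. all: by end_near. Qed.

Lemma bounded01 (f : R -> R) : continuous f ->
  \forall k \near \oo, forall u, 0 <= u <= 1 -> `|f u| <= k.+1%:R.
Proof.
move=> cf.
have [|c _ hc] := @EVT_max R (fun u => `|f u|) 0 1 ler01.
  by apply: continuous_subspaceT => u; apply: cvg_norm; exact: cf.
exists (Num.truncn `|f c|) => // k /= hk u u01.
apply: le_trans (hc u _) _; first by rewrite in_itv.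
by apply: ltW; apply: lt_le_trans (truncnS_gt _) _; rewrite ler_nat ltnS.
Qed.

Lemma near_all (I : finType) (P : I -> nat -> Prop) :
  (forall i, \forall k \near \oo, P i k) -> exists k, forall i, P i k.
Proof.
move=> h; have : \forall k \near \oo, forall i, P i k by exact: filter_forall.
by move=> [k _ /(_ k (leqnn k)) hk]; exists k.
Qed.

Section Codes.
Context {n : nat}.
Implicit Types f g : 'I_n -> R -> R.

(** Integer entries keep the set of codes countable; [k.+2] grid points include both 0 and 1. *)
Definition grid_values f (k j : nat) : seq (seq int) :=
  [seq [seq Num.floor (f i (l%:R / k.+1%:R) * j.+1%:R) | l <- iota 0 k.+2] | i <- enum 'I_n].

(* The code records a bound [M], a modulus of continuity at scale [j] and the
   values of [f] on a grid, rounded at scale [j]. *)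
Definition has_code f (c : nat * nat * nat * seq (seq int)) : Prop :=
  let: (M, j, k, tab) := c in
  [/\ forall i u, 0 <= u <= 1 -> `|f i u| <= M.+1%:R,
      forall i u, 0 <= u <= 1 -> forall v, `|u - v| <= (k.+1%:R)^-1 ->
        `|f i u - f i v| <= (j.+1%:R)^-1 &
      tab = grid_values f k j].

(** The bound [M] precedes the precision [j], which will be chosen in terms of [M]. *)
Lemma has_code_ex f : (forall i, continuous (f i)) ->
  exists M, forall j, exists k tab, has_code f (M, j, k, tab).
Proof.
move=> cf; have [M hM] := near_all (fun i => bounded01 (cf i)).
exists M => j.
have j0 : 0 < (j.+1%:R)^-1 :> R by rewrite invr_gt0.
have [k hk] := near_all (fun i => unif_continuous01 (cf i) j0).
by exists k, (grid_values f k j); split.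
Qed.

Lemma grid_values_eq f g k j i l : grid_values f k j = grid_values g k j -> (l < k.+2)%N ->
  Num.floor (f i (l%:R / k.+1%:R) * j.+1%:R) = Num.floor (g i (l%:R / k.+1%:R) * j.+1%:R).
Proof.
move=> /eq_in_map fg lk; have /eq_in_map := fg i (mem_enum _ _); apply.
by rewrite mem_iota.
Qed.

Lemma floor_eq_close (a b : R) (j : nat) :
  Num.floor (a * j.+1%:R) = Num.floor (b * j.+1%:R) -> `|a - b| <= (j.+1%:R)^-1.
Proof.
move=> ab; have j0 : 0 < j.+1%:R :> R by [].
have := floor_itv (a * j.+1%:R); have := floor_itv (b * j.+1%:R).
rewrite ab intrD => /andP[h1 h2] /andP[h3 h4].
rewrite -[leRHS]mul1r ler_pdivlMr // -{1}(gtr0_norm j0) -normrM mulrBl ler_norml.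
by apply/andP; split; lra.
Qed.

(** Three errors: from [u] to the grid point [v] just below it along [f], the rounding at [v], and
    back to [u] along [g]. *)
Lemma has_code_close f g M j k tab : has_code f (M, j, k, tab) -> has_code g (M, j, k, tab) ->
  forall i u, 0 <= u <= 1 -> `|f i u - g i u| <= 3 * (j.+1%:R)^-1.
Proof.
move=> [_ fk ->] [_ gk /esym fg] i u u01.
have k0 : 0 < k.+1%:R :> R by [].
have uk0 : 0 <= u * k.+1%:R by rewrite mulr_ge0 //; case/andP: u01.
pose l := Num.truncn (u * k.+1%:R); pose v := l%:R / k.+1%:R : R.
have /andP[l1 l2] := truncn_itv uk0.
have lk : (l < k.+2)%N.
  rewrite ltnS -(ler_nat R); apply: le_trans l1 _.
  by rewrite ler_piMl //; case/andP: u01.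
have uv : `|u - v| <= (k.+1%:R)^-1.
  rewrite -[leRHS]mul1r ler_pdivlMr // -{1}(gtr0_norm k0) -normrM mulrBl divfK ?gt_eqF //.
  rewrite -/l -natr1 in l1 l2; rewrite ler_norml; apply/andP; split; lra.
have h1 := fk i u u01 v uv; have h2 := gk i u u01 v uv.
have h3 := floor_eq_close (grid_values_eq i fg lk); rewrite distrC in h3.
have -> : f i u - g i u = (f i u - f i v) + (f i v - g i v) - (g i u - g i v) by ring.
apply: le_trans (ler_normB _ _) _; apply: le_trans (lerD (ler_normD _ _) (lexx _)) _.
have -> : 3 * (j.+1%:R)^-1 = (j.+1%:R)^-1 + (j.+1%:R)^-1 + (j.+1%:R)^-1 :> R by ring.
exact: lerD (lerD h1 h3) h2.
Qed.

End Codes.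
End Separability.

(** * The countable dense subset *)

Unset Implicit Arguments.
Set Strict Implicit.

Theorem theorem22 (R : realType) (V : finNormedModType R) (m : nat) (p : R)
    (N : tensor_of V m -> R) (omega : R -> R -> R) (K : R)
    (m_ge1 : (1 <= m)%N) (p_ge1 : 1 <= p)
    (N_norm : homogeneous_norm N)
    (omega_control : control omega)
    (K_gt0 : 0 < K)
    (omega_ge : forall s t : R, 0 <= s -> s < t -> t <= 1 ->
       K * (t - s) `^ p <= omega s t) :
  separable_metric (d_omega_p N omega p) (C0 N omega p).
Proof.
have hN := homogeneous_norm_lnorm m_ge1 N_norm.
pose n := \dim (fullv : {vspace V}).
(* Choosing elements of [C0] itself, rather than lifts, makes the countable set a subset of [C0] by
   construction. *)
pose A (q : nat * (nat * nat * nat * seq (seq int))) : set (R -> tensor_of V m) :=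
  [set z | C0 N omega p z /\ exists x, [/\ smooth x, has_code (path_velocity x) q.2 &
     (d_omega_p N omega p z (signature_path x) < (q.1.+1%:R^-1)%:E)%E]].
have /choice[F FA] : forall q, exists z, A q !=set0 -> A q z.
  move=> q; have [[z Az]|nA] := pselect (A q !=set0); first by exists z.
  (* A default for pairs realised by no element; it is excluded from the image below. *)
  by exists (fun=> 0).
exists (F @` [set q | A q !=set0]); split.
- apply: sub_countable (card_image_le _ _) _; exact: countableP.
- by move=> _ [q /FA[] ? _ <-].
move=> Y CY e e0.
(* Three errors of size [e'] leave the supremum strictly below [e]. *)
pose e' := e / 4; have e'0 : 0 < e' by rewrite divr_gt0.
have [j hj] := exists_inv_le e'0.
have [GY /(_ (j.+1%:R^-1))[|x [sx dYx]]] := CY; first by rewrite invr_gt0.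
have cx i : continuous (path_velocity x i) by exact: path_velocity_continuous.
have [M hM] := has_code_ex cx.
have Kp0 : 0 < K `^ p^-1 by exact: powR_gt0.
have M1 : 1 <= M.+1%:R :> R by rewrite ler1n.
have [delta delta0 hdelta] := lnorm_transport_close m_ge1 hN M1 (mulr_gt0 e'0 Kp0).
have [l hl] := exists_inv_le (divr_gt0 delta0 (ltr0n R 3)).
have [k [tab hx]] := hM l.
pose q := (j, (M, l, k, tab)).
(* [Y] itself realises [q], so the chosen [F q] is close to the lift of some path with the same code
   as [x]. *)
have Aq : A q !=set0 by exists Y; split => //; exists x.
exists (F q); first by exists q.
have [[GF _] [x' [sx' hx' dFx']]] := FA q Aq.
have cx' i : continuous (path_velocity x' i) by exact: path_velocity_continuous.
set z := F q in GF dFx' *.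
apply: (@le_lt_trans _ _ (3 * e')%:E); last by rewrite lte_fin /e'; lra.
apply: ub_ereal_sup => _ [s [t [s0 st t1 ->]]]; rewrite lee_fin.
have w0 : 0 < omega s t.
  apply: lt_le_trans (omega_ge _ _ s0 st t1); apply: mulr_gt0 => //.
  by apply: powR_gt0; rewrite subr_gt0.
set w := omega s t `^ p^-1.
have w_gt0 : 0 < w by exact: powR_gt0.
have p0 : 0 < p by exact: lt_le_trans p_ge1.
(* The [p]-th root of the lower bound on the control. *)
have wK : K `^ p^-1 * (t - s) <= w.
  have ts0 : 0 <= t - s by rewrite subr_ge0 ltW.
  rewrite [leLHS](_ : _ = (K * (t - s) `^ p) `^ p^-1); last first.
    by rewrite powRM ?powR_ge0 1?ltW // -powRrM mulfV ?lt0r_neq0 // powRr1.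
  apply: ge0_ler_powR; [by rewrite invr_ge0 ltW | | by rewrite nnegrE ltW | exact: omega_ge].
  by rewrite nnegrE mulr_ge0 ?powR_ge0 // ltW.
have dist_le (a b : R -> tensor_of V m) : (d_omega_p N omega p a b < (j.+1%:R^-1)%:E)%E ->
    dm N (incr a s t) (incr b s t) <= e' * w.
  move=> dab; rewrite -ler_pdivrMr // -lee_fin; apply: le_trans (le_trans (ltW dab) _).
    by apply: ereal_sup_ubound; exists s, t; split.
  by rewrite lee_fin.
have Lincr y : Gpath y -> lgrp (incr y s t : ttensor R n m).
  case=> _ Gy _; have s01 : s \in `[0, 1] by rewrite in_itv /= s0 (le_trans (ltW st)).
  have t01 : t \in `[0, 1] by rewrite in_itv /= t1 (le_trans s0 (ltW st)).
  have /(GmP _ m_ge1) Ls := Gy s s01; have /(GmP _ m_ge1) Lt := Gy t t01.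
  by apply: lgrpM => //; exact: lgrpV.
have LY := Lincr _ GY; have Lz := Lincr _ GF.
have := dist_le _ _ dYx; have := dist_le _ _ dFx'.
rewrite /dm !incr_signature ?(ltW st) //.
have LX := lgrp_transport s t m_ge1 cx; have LX' := lgrp_transport s t m_ge1 cx'.
have hl3 : 3 * (l.+1%:R^-1) <= delta by rewrite mulrC -ler_pdivlMr.
have dxx' : N (tinv (transport (path_velocity x) s t) * transport (path_velocity x') s t)
    <= e' * w.
  have [bx _ _] := hx; have [bx' _ _] := hx'.
  have xx' i u : 0 <= u <= 1 -> `|path_velocity x i u - path_velocity x' i u| <= delta.
    by move=> u01; apply: le_trans (has_code_close hx hx' i u01) hl3.
  apply: le_trans (hdelta _ _ cx cx' bx bx' xx' _ _ s0 st t1) _.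
  by rewrite -mulrA ler_pM2l.
rewrite ler_pdivrMr //.
move=> zX' YX; apply: le_trans (lnorm_quadrangle m_ge1 hN LY LX LX' Lz) _.
have -> : 3 * e' * w = e' * w + e' * w + e' * w by ring.
exact: lerD (lerD YX dxx') zX'.
Qed.
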